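(* Let $k,n\in\mathbb N$ with $1\le k\le n$, let $\lambda\vdash n$ and $x\in\lambda$. Then the map $$\Psi:\operatorname{T}(\lambda,k\to x)\times\{k,\dots,n\}\to\operatorname{H}(\lambda)\times\operatorname{SYT}(\lambda,x\ge k),\qquad (T,l)\mapsto\Phi((k\,l)\circ T),$$ is well defined and a bijection, where $(k\,l)\in\mathfrak S_n$ is the transposition of the values $k$ and $l$ (the identity if $l=k$) and $\Phi$ is the Novelli--Pak--Stoyanovskii bijection.
   Context: A partition $\lambda\vdash n$ is identified with its Young diagram $\{(i,j): i\ge1,\ 1\le j\le\lambda_i\}$; $\lambda'$ is its conjugate. Arm and leg of $x=(i,j)$: $\operatorname{arm}(x)=\lambda_i-j$, $\operatorname{leg}(x)=\lambda'_j-i$. A hook tableau is a map $H:\lambda\to\mathbb Z$ with $-\operatorname{leg}(x)\le H(x)\le\operatorname{arm}(x)$ for all $x$; $\operatorname{H}(\lambda)$ is their set. A tabloid is a bijection $T:\lambda\to\{1,\dots,n\}$; $\operatorname{T}(\lambda)$ is their set, acted on by $\mathfrak S_n$ via $\sigma\circ T$. A standard Young tableau is a tabloid with entries increasing along rows and down columns; $\operatorname{SYT}(\lambda,x\ge k)$ is the set of standard Young tableaux $U$ of shape $\lambda$ with $U(x)\ge k$. Order cells by $(i,j)\prec(k,l)$ iff $j<l$, or $j=l$ and $i<k$; list them $z_1\prec\dots\prec z_n$. Novelli--Pak--Stoyanovskii sorting of $T$: $T_{z_n}:=T$; for $m=n-1,\dots,1$, $T_{z_m}$ is obtained from $T_{z_{m+1}}$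 by the slide at $z_m$, which repeatedly exchanges the entry in $z_m$ with the smaller of the entries in its current right and bottom neighbours as long as that entry is smaller than it. $\operatorname{T}(\lambda,k\to x)$ is the set of $T\in\operatorname{T}(\lambda)$ such that, with $T(z)=k$, $T_z(x)=k$ (the entry $k$ is moved to $x$ by its own slide). The Novelli--Pak--Stoyanovskii bijection $\Phi:\operatorname{T}(\lambda)\to\operatorname{H}(\lambda)\times\operatorname{SYT}(\lambda)$ maps $T$ to $(H,U)$ with $U=T_{z_1}$ the sorted output, and $H$ built alongside: start with $H\equiv0$; when the slide at $z_m=(a,b)$ moves the entry from $(a,b)$ to its final cell $(a',b')$, replace $H(c,b)$ by the old value of $H(c+1,b)$ minus $1$ for $a\le c<a'$, and set $H(a',b):=b'-b$. $\Phi$ is a bijection. *)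

(* Defs.v *)
From mathcomp Require Import all_boot all_order all_algebra.
Set Implicit Arguments. Unset Strict Implicit. Unset Printing Implicit Defensive.
Import GRing.Theory Num.Theory.

Local Open Scope nat_scope.

(* A cell (i,j): row i, column j, both 0-indexed (paper's (i+1, j+1)). *)
Definition cell := (nat * nat)%type.

Definition is_partition (n : nat) (la : seq nat) : bool :=
  [&& sorted geq la, all (fun r => 0 < r) la & sumn la == n].

Definition col_len (la : seq nat) (j : nat) : nat := count (fun r => j < r) la.

Definition in_diag (la : seq nat) (x : cell) : bool :=
  (x.1 < size la) && (x.2 < nth 0 la x.1).

Definition arm (la : seq nat) (x : cell) : nat := nth 0 la x.1 - x.2.+1.
Definition leg (la : seq nat) (x : cell) : nat := col_len la x.2 - x.1.+1.

Definition cells (la : seq nat) : seq cell :=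
  flatten [seq [seq (i, j) | i <- iota 0 (col_len la j)] | j <- iota 0 (head 0 la)].

Definition getT {A : Type} (d : A) (T : seq (seq A)) (x : cell) : A :=
  nth d (nth [::] T x.1) x.2.
Definition setT {A : Type} (d : A) (T : seq (seq A)) (x : cell) (v : A) :=
  set_nth [::] T x.1 (set_nth d (nth [::] T x.1) x.2 v).

Definition tab := seq (seq nat).
Definition htab := seq (seq int).

Definition get (T : tab) x := getT 0 T x.
Definition hget (H : htab) x := getT 0%R H x.

Definition is_tabloid (la : seq nat) (n : nat) (T : tab) : bool :=
  (map size T == la) && perm_eq (flatten T) (iota 1 n).

Definition is_SYT (la : seq nat) (n : nat) (U : tab) : bool :=
  [&& is_tabloid la n U,
      all (fun x => in_diag la (x.1, x.2.+1) ==> (get U x < get U (x.1, x.2.+1)))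
          (cells la) &
      all (fun x => in_diag la (x.1.+1, x.2) ==> (get U x < get U (x.1.+1, x.2)))
          (cells la)].

Definition is_hook_tableau (la : seq nat) (H : htab) : bool :=
  (map size H == la) &&
  all (fun x => (- (leg la x)%:Z <= hget H x)%R && (hget H x <= (arm la x)%:Z)%R)
      (cells la).

Definition swapT (T : tab) (p q : cell) : tab :=
  setT 0 (setT 0 T p (get T q)) q (get T p).

(* one slide: the entry at p is repeatedly exchanged with the smaller of its
   right and bottom neighbours while that one is smaller; returns the new
   filling and the final position of the moved entry.  The fuel is large
   enough (the path has length at most arm + leg < n). *)
Fixpoint slide_aux (fuel : nat) (la : seq nat) (T : tab) (p : cell)
  : tab * cell :=
  match fuel with
  | 0 => (T, p)
  | f.+1 =>
    let r := (p.1, p.2.+1) in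
    let d := (p.1.+1, p.2) in
    let cand :=
      if in_diag la r && in_diag la d then
        (if get T r < get T d then Some r else Some d)
      else if in_diag la r then Some r
      else if in_diag la d then Some d
      else None in
    match cand with
    | Some q => if get T q < get T p then slide_aux f la (swapT T p q) q
                else (T, p)
    | None => (T, p)
    end
  end.

Definition slide (la : seq nat) (T : tab) (p : cell) : tab * cell :=
  slide_aux (sumn la) la T p.

Definition hook_update (H : htab) (z z' : cell) : htab :=
  let H1 := foldl (fun acc c => setT 0%R acc (c, z.2) (hget H (c.+1, z.2) - 1)%R)
                  H (iota z.1 (z'.1 - z.1)) in
  setT 0%R H1 (z'.1, z.2) (z'.2%:Z - z.2%:Z)%R.

Definition H0 (la : seq nat) : htab := [seq nseq r 0%R | r <- la].

Definition nps_step (la : seq nat) (TH : tab * htab) (z : cell) : tab * htab :=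
  let: (T', z') := slide la TH.1 z in (T', hook_update TH.2 z z').

(* Run the NPS algorithm from T = T_{z_n} through the slides at
   z_{n-1}, ..., z_{p+1} (1-indexed), i.e. over the 0-indexed list positions
   n-2 down to p. The first component is T_{z_{p+1}}. *)
Definition nps_run (la : seq nat) (T : tab) (p : nat) : tab * htab :=
  foldl (nps_step la) (T, H0 la)
        (rev (drop p (take (size (cells la)).-1 (cells la)))).

Definition T_at (la : seq nat) (T : tab) (z : cell) : tab :=
  (nps_run la T (index z (cells la))).1.

Definition Phi (la : seq nat) (T : tab) : htab * tab :=
  let: (U, H) := nps_run la T 0 in (H, U).

Definition pos_of (la : seq nat) (T : tab) (k : nat) : cell :=
  nth (0, 0) (cells la) (find (fun z => get T z == k) (cells la)).

Definition in_T_k_to_x (la : seq nat) (n k : nat) (x : cell) (T : tab) : bool :=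
  is_tabloid la n T && (get (T_at la T (pos_of la T k)) x == k).

Definition transp_tab (k l : nat) (T : tab) : tab :=
  map (map (fun v => if v == k then l else if v == l then k else v)) T.

Definition Psi (la : seq nat) (k : nat) (T : tab) (l : nat) : htab * tab :=
  Phi la (transp_tab k l T).

(* Main.v *)
Require Import Defs.
From mathcomp Require Import all_boot all_order all_algebra zify.
Set Implicit Arguments. Unset Strict Implicit. Unset Printing Implicit Defensive.

(* The slide at a cell [z] moves the entry of [z] along the forward path of [z],
   which always steps to the smaller of the right and lower neighbours.  Inside a
   sorted filling, a backward path steps to the larger of the left and upper
   neighbours; a slide can be undone along the backward path from its final cell.
   While a column [b] is being processed upwards, the hook entry [J i] in row [i]
   records a candidate [(i, b + J i)] for the final cell of the last slide.
   Forward and backward paths of the same filling cross in one direction only, so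
   that
   - all candidates stay weakly below the forward path of the next cell [z];
   - after the slide at [z], the final cell [e] is the only candidate such that
     the candidates above it lie strictly left of the backward path from [e], and
     those below it lie weakly below the forward path continuing from [e];
   - such a candidate exists in every filling satisfying the first property.
   Hence every slide, seen as an operation on such pairs (filling, hooks), is a
   bijection, and so is [Phi].

   For [Psi], call an entry large if it is at least [k].  The positions of the
   small entries do not depend on how the large entries are arranged.  If [w] is a
   large cell, let [X w] be the final cell of the slide at [w] when the entry there
   is [k].  Each slide at a large cell [w] adds the single cell [X w] to the large
   processed cells, so [X] is a bijection from the initial large cells to the
   final ones.  Given [(H, U) = Phi T'] with [k <= U x], there is then exactly one
   [w] with [X w = x], and [l = T' w] is the only value with
   [(k l) o T'] in the domain of [Psi]. *)

(** * Forward and backward paths *)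

Definition grid := nat -> nat -> nat.

(* A path is given by the column [u i] in which it enters row [i]: within row [i]
   it occupies the columns from [u i] to [u i.+1]. *)
Definition is_fwd (f : grid) (r : nat) (u : nat -> nat) : Prop :=
  forall i, r <= i ->
  [/\ u i <= u i.+1,
      forall j, u i <= j < u i.+1 -> f i j.+1 < f i.+1 j
    & f i.+1 (u i.+1) <= f i (u i.+1).+1].

(* [v] describes a path as above, from [(A, v A)] to [(a, v a.+1)]. *)
Record is_back (f : grid) (A a : nat) (v : nat -> nat) : Prop := IsBack {
  back_mono : forall i, A <= i <= a -> v i <= v i.+1;
  back_right : forall i j, A <= i <= a -> v i <= j < v i.+1 -> f i.-1 j.+1 < f i j;
  back_down : forall i, A <= i < a -> f i.+1 (v i.+1).-1 < f i (v i.+1) }.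

Definition on_path (A a : nat) (v : nat -> nat) (i j : nat) : bool :=
  (A <= i <= a) && (v i <= j <= v i.+1).

(* [g] results from [f] by sliding the entry [x0] from [(A, v A)] to
   [(a, v a.+1)]; the value of [f] at the starting cell is irrelevant. *)
Record slid (f g : grid) (x0 A a : nat) (v : nat -> nat) : Prop := Slid {
  slid_rows : A <= a;
  slid_mono : forall i, A <= i <= a -> v i <= v i.+1;
  slid_right : forall i j, A <= i <= a -> v i <= j < v i.+1 ->
    [/\ f i j.+1 < f i.+1 j, f i j.+1 < x0 & g i j = f i j.+1];
  slid_down : forall i, A <= i < a ->
    [/\ f i.+1 (v i.+1) < f i (v i.+1).+1, f i.+1 (v i.+1) < x0
      & g i (v i.+1) = f i.+1 (v i.+1)];
  slid_end : [/\ g a (v a.+1) = x0, x0 < f a (v a.+1).+1 & x0 < f a.+1 (v a.+1)];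
  slid_off : forall i j, ~~ on_path A a v i j -> g i j = f i j }.

(** The entry 0 marks cells not yet processed and [N] cells outside the diagram; strict growth is
    required only between these values. The processed cells are those from [(A, B)] on, columns
    being processed from right to left and each from the bottom up. Row 0 is padding: 0 up to column
    [M], and [N] beyond. *)
Record sorted_grid (N M A B : nat) (f : grid) : Prop := SortedGrid {
  sg_top : forall i j, f i j <= N;
  sg_row : forall i j, f i j <= f i j.+1;
  sg_col : forall i j, f i j <= f i.+1 j;
  sg_row_lt : forall i j, 0 < f i j < N -> f i j < f i j.+1;
  sg_col_lt : forall i j, 0 < f i j < N -> f i j < f i.+1 j;
  sg_zero : forall i j, 0 < i -> (f i j == 0) = (j < B) || (j == B) && (i < A);
  sg_row0 : forall j, j <= M -> f 0 j = 0;
  sg_far : forall i j, M < j -> f i j = N }.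

Lemma fwd_exists (N M : nat) (f : grid) (r j0 : nat) :
  (forall i j, f i j <= N) -> (forall i j, M < j -> f i j = N) ->
  exists2 u, u r = j0 & is_fwd f r u.
Proof.
move=> ftop ffar.
(* [p i j t] says that the path may turn down at column [j + t]. The choice [t = M] always works,
   since the right neighbour then lies beyond column [M] and has the value [N]. *)
pose p i j t := f i.+1 (j + t) <= f i (j + t).+1.
pose nxt i j := j + find (p i j) (iota 0 M.+1).
have hasp i j : has (p i j) (iota 0 M.+1).
  by apply/hasP; exists M; rewrite ?mem_iota ?leq0n ?add0n //= /p (ffar i) //; lia.
pose fix U d := if d is d'.+1 then nxt (r + d') (U d') else j0.
exists (fun i => U (i - r)); first by rewrite subnn.
move=> i ri; rewrite subSn //=.
set j := U _; rewrite (subnKC ri) /nxt; set t := find _ _.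
have tlt : t < M.+1 by move: (hasp i j); rewrite has_find size_iota.
split; first lia.
- move=> j' /andP[j1 j2].
  have := @before_find _ 0 (p i j) (iota 0 M.+1) (j' - j).
  rewrite -/t nth_iota ?add0n; last lia.
  by rewrite /p subnKC // => /(_ ltac:(lia)); lia.
- by have := nth_find 0 (hasp i j); rewrite -/t nth_iota // add0n /p.
Qed.

Lemma fwd_mono (f : grid) r u i j : is_fwd f r u -> r <= i <= j -> u i <= u j.
Proof.
move=> fu /andP[ri]; elim: j => [|j IH]; first by rewrite leqn0 => /eqP->.
rewrite leq_eqVlt => /orP[/eqP->//|ij].
by have [] := fu j (leq_trans ri ij) => *; apply: leq_trans (IH ij) _.
Qed.

Lemma back_le (f : grid) A a v i j :
  is_back f A a v -> A <= i -> i <= j -> j <= a.+1 -> v i <= v j.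
Proof.
move=> fv Ai; elim: j => [|j IH]; first by rewrite leqn0 => /eqP->.
rewrite leq_eqVlt => /orP[/eqP->//|ij] ja.
apply: leq_trans (IH _ _) _; rewrite ?(ltnW ja) //.
by apply: (back_mono fv); lia.
Qed.

Lemma slid_le (f g : grid) x0 A a v i j :
  slid f g x0 A a v -> A <= i -> i <= j -> j <= a.+1 -> v i <= v j.
Proof.
move=> fv Ai; elim: j => [|j IH]; first by rewrite leqn0 => /eqP->.
rewrite leq_eqVlt => /orP[/eqP->//|ij] ja.
apply: leq_trans (IH _ _) _; rewrite ?(ltnW ja) //.
by apply: (slid_mono fv); lia.
Qed.

(** To cross, the forward path must turn down at some [(i, j)] while the backward path runs from
    [(i.+1, j)] to [(i.+1, j.+1)]. Both choices compare the entries at [(i.+1, j)] and [(i, j.+1)],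
    with opposite outcomes. *)
Lemma fwd_above_back (g : grid) A a v r u :
  is_back g A a v -> is_fwd g r u -> A <= r.+1 -> v r.+1 <= u r ->
  forall i, r <= i <= a -> v i.+1 <= u i.
Proof.
move=> gv gu Ar vu; elim=> [|i IH]; first by case: r gu Ar vu.
rewrite leq_eqVlt => /andP[/orP[/eqP<-//|ri]] ia.
have {}IH : v i.+1 <= u i by apply: IH; lia.
have [u1 u2 u3] := gu i ri.
rewrite leqNgt; apply/negP => lt.
have := @back_right _ _ _ _ gv i.+1 (u i.+1) ltac:(lia) ltac:(lia).
by rewrite /=; lia.
Qed.

(** To reach the column where the backward path passes from row [i] to row [i.+1], the forward path
    would step right into [(i, v i.+1)]. Its choice and [back_down] compare the same two entries,
    with opposite outcomes. *)
Lemma fwd_below_back (g : grid) A a v r u :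
  is_back g A a v -> is_fwd g r u -> A <= r -> u r < v r.+1 ->
  forall i, r < i <= a -> u i < v i.
Proof.
move=> gv gu Ar uv.
have aux i : r <= i < a -> u i < v i.+1 -> u i.+1 < v i.+1.
  move=> ria uvi; have [u1 u2 u3] := gu i ltac:(lia).
  rewrite ltnNge; apply/negP => lt.
  have := u2 (v i.+1).-1 ltac:(lia).
  have := back_down gv (i := i) ltac:(lia).
  by rewrite prednK; lia.
elim=> [|i IH]; first by [].
rewrite ltnS leq_eqVlt => /andP[/orP[/eqP<-|ri]] ia; first by apply: aux; lia.
apply: aux; first lia.
apply: leq_trans (IH _) _; first lia.
by apply: (back_mono gv); lia.
Qed.

(** In the first row where [v] overtakes [u], it steps right at column [u i.+1], where [u] turns
    down. Both choices look at the same two cells, and there the fillings agree. *)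
Lemma fwd_compare (f g : grid) r u v :
  is_fwd f r u -> is_fwd g r v -> v r <= u r ->
  (forall j, u r <= j -> f r j.+1 = g r j.+1) ->
  (forall i j, r < i -> f i j = g i j) ->
  forall i, r <= i -> v i <= u i.
Proof.
move=> fu gv vu e1 e2; elim=> [|i IH]; first by case: r fu gv vu {e1 e2}.
rewrite leq_eqVlt => /orP[/eqP<-//|ri].
have {}IH := IH ri.
have [u1 u2 u3] := fu i ri; have [v1 v2 v3] := gv i ri.
rewrite leqNgt; apply/negP => lt.
have := v2 (u i.+1) ltac:(lia).
rewrite -(e2 i.+1) //.
have -> : g i (u i.+1).+1 = f i (u i.+1).+1.
  case: (eqVneq r i) => [eri|nri]; last by rewrite e2 //; lia.
  by rewrite -eri e1 // eri.
lia.
Qed.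

(** A slide follows the forward path as long as it moves. In its last row it may stop before the
    forward path turns down, hence only an inequality at [a.+1]. *)
Lemma slid_fwd (f g : grid) x0 A a v u :
  slid f g x0 A a v -> is_fwd f A u -> u A = v A ->
  (forall i, A <= i <= a -> u i = v i) /\ v a.+1 <= u a.+1.
Proof.
move=> sl fu uv.
have le i : A <= i <= a -> u i = v i -> v i.+1 <= u i.+1.
  move=> Aia e; rewrite leqNgt; apply/negP => lt.
  have [u1 u2 u3] := fu i ltac:(lia).
  have [] := @slid_right _ _ _ _ _ _ sl i (u i.+1) ltac:(lia) ltac:(lia).
  by lia.
have eq i : A <= i <= a -> u i = v i.
  elim: i => [|i IH]; first by move=> /andP[]; case: A uv {sl fu le}.
  rewrite leq_eqVlt => /andP[/orP[/eqP<-//|ri]] ia.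
  have {}IH := IH ltac:(lia).
  apply/eqP; rewrite eqn_leq le ?andbT //; last lia.
  rewrite leqNgt; apply/negP => lt.
  have [u1 u2 u3] := fu i ltac:(lia).
  have := u2 (v i.+1); rewrite IH (slid_mono sl) ?lt //; last lia.
  move/(_ isT); have [] := slid_down sl (i := i) ltac:(lia).
  by lia.
split=> //; apply: le; last apply: eq; move: (slid_rows sl); lia.
Qed.

(** The direction of each step is forced, and a slide going further than the other would exchange
    [x0] with an entry that stopped the other one. *)
Lemma slid_unique (f g1 g2 : grid) x0 A a1 a2 v1 v2 :
  slid f g1 x0 A a1 v1 -> slid f g2 x0 A a2 v2 -> v1 A = v2 A ->
  [/\ a1 = a2, v1 a1.+1 = v2 a2.+1 & forall i j, g1 i j = g2 i j].
Proof.
have key g1' g2' a1' a2' v1' v2' (s1 : slid f g1' x0 A a1' v1')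
    (s2 : slid f g2' x0 A a2' v2') : v1' A = v2' A -> a1' <= a2' ->
    [/\ a1' = a2', v1' a1'.+1 = v2' a2'.+1
      & forall i, A <= i <= a1' -> v1' i = v2' i].
  move=> e12 le12.
  have eq i : A <= i <= a1' -> v1' i = v2' i.
    elim: i => [|i IH]; first by move=> /andP[]; case: A e12 {s1 s2}.
    rewrite leq_eqVlt => /andP[/orP[/eqP<-//|ri]] ia.
    have {}IH := IH ltac:(lia).
    have [d1 _ _] := slid_down s1 (i := i) ltac:(lia).
    have [d2 _ _] := slid_down s2 (i := i) ltac:(lia).
    have m1 := slid_mono s1 (i := i) ltac:(lia).
    have m2 := slid_mono s2 (i := i) ltac:(lia).
    case: (ltngtP (v1' i.+1) (v2' i.+1)) => // lt.
      by have [] := @slid_right _ _ _ _ _ _ s2 i (v1' i.+1) ltac:(lia) ltac:(lia); lia.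
    by have [] := @slid_right _ _ _ _ _ _ s1 i (v2' i.+1) ltac:(lia) ltac:(lia); lia.
  have r1 := slid_rows s1.
  have e := eq a1' ltac:(lia).
  have [_ x1 y1] := slid_end s1; have [_ x2 y2] := slid_end s2.
  have m1 := slid_mono s1 (i := a1') ltac:(lia).
  have m2 := slid_mono s2 (i := a1') ltac:(lia).
  have b12 : v2' a1'.+1 <= v1' a1'.+1.
    rewrite leqNgt; apply/negP => lt.
    by have [] := @slid_right _ _ _ _ _ _ s2 a1' (v1' a1'.+1) ltac:(lia) ltac:(lia); lia.
  have a12 : a1' = a2'.
    apply/eqP; rewrite eqn_leq le12 leqNgt; apply/negP => lt.
    have [d2 d3 _] := slid_down s2 (i := a1') ltac:(lia).
    case: (ltngtP (v2' a1'.+1) (v1' a1'.+1)) b12 => // [{}lt|eb] _.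
      have [] := @slid_right _ _ _ _ _ _ s1 a1' (v2' a1'.+1) ltac:(lia) ltac:(lia).
      by lia.
    by rewrite eb in d3; lia.
  split=> //; rewrite -a12 in s2 x2 y2 *.
  apply/eqP; rewrite eqn_leq b12 andbT leqNgt; apply/negP => lt.
  by have [] := @slid_right _ _ _ _ _ _ s1 a1' (v2' a1'.+1) ltac:(lia) ltac:(lia); lia.
move=> s1 s2 e.
have [a12 b12 eqv] : [/\ a1 = a2, v1 a1.+1 = v2 a2.+1
    & forall i, A <= i <= a1 -> v1 i = v2 i].
  case/orP: (leq_total a1 a2) => le; first exact: key s1 s2 e le.
  have [ea eb ev] := key _ _ _ _ _ _ s2 s1 (esym e) le.
  by split=> // i; rewrite -ea => /ev.
split=> // i j; rewrite -{}a12 in s2 b12.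
have eqv' k : A <= k <= a1.+1 -> v1 k = v2 k.
  move=> /andP[Ak]; rewrite leq_eqVlt => /orP[/eqP->//|ka]; apply: eqv; lia.
have op : on_path A a1 v1 i j = on_path A a1 v2 i j.
  rewrite /on_path; case: (boolP (A <= i <= a1)) => //= Ai.
  by rewrite !eqv'; lia.
case: (boolP (on_path A a1 v1 i j)) => [on|off]; last first.
  by rewrite (slid_off s1) ?(slid_off s2) -?op.
case/andP: on => Ai /andP[vj jv].
have e1 := eqv' i ltac:(lia); have e2 := eqv' i.+1 ltac:(lia).
case: (ltngtP j (v1 i.+1)) jv => // [lt|eq] _.
  have [_ _ ->] := slid_right s1 Ai (j := j) ltac:(lia).
  by have [_ _ ->] := slid_right s2 Ai (j := j) ltac:(lia).
case: (eqVneq i a1) => [ea|ia].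
  rewrite eq ea; have [-> _ _] := slid_end s1; rewrite b12.
  by have [-> _ _] := slid_end s2.
rewrite eq; have [_ _ ->] := slid_down s1 (i := i) ltac:(lia).
by rewrite e2; have [_ _ ->] := slid_down s2 (i := i) ltac:(lia).
Qed.

(** The paths are followed from their common last cell upwards. Where they part, one goes left and
    the other up, on opposite outcomes of the same comparison. *)
Lemma back_unique (g : grid) A a v1 v2 :
  is_back g A a v1 -> is_back g A a v2 -> v1 A = v2 A -> v1 a.+1 = v2 a.+1 ->
  forall i, A <= i <= a.+1 -> v1 i = v2 i.
Proof.
move=> b1 b2 eA ea.
have key w1 w2 i : is_back g A a w1 -> is_back g A a w2 -> A < i <= a ->
    w1 i.+1 = w2 i.+1 -> w2 i <= w1 i.
  move=> c1 c2 Ai e; rewrite leqNgt; apply/negP => lt.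
  have m2 := back_mono c2 (i := i) ltac:(lia).
  have h := @back_right _ _ _ _ c1 i (w2 i).-1 ltac:(lia) ltac:(lia).
  have := back_down c2 (i := i.-1) ltac:(lia).
  rewrite !(@prednK i) ?(@prednK (w2 i)) in h *; lia.
suff ind d : d <= a.+1 - A -> v1 (a.+1 - d) = v2 (a.+1 - d).
  by move=> i Ai; have := ind (a.+1 - i) ltac:(lia); rewrite subKn //; lia.
elim: d => [|d IH] da; first by rewrite subn0.
have {}IH := IH ltac:(lia).
have e : a.+1 - d = (a.+1 - d.+1).+1 by lia.
rewrite {}e in IH; set i := a.+1 - d.+1 in IH *.
case: (eqVneq i A) => [->//|iA].
by apply/eqP; rewrite eqn_leq; apply/andP; split; apply: key; rewrite //; lia.
Qed.

(** Undoing a slide puts its path in front of the forward path of the final cell. This yields the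
    path condition for an undone step. *)
Lemma fwd_of_slid (f g : grid) x0 A a v u :
  slid f g x0 A a v -> is_fwd g a u -> u a = v a.+1 ->
  is_fwd f A (fun i => if i <= a then v i else u i).
Proof.
move=> sl gu ua i Ai /=; have Aa := slid_rows sl.
have same j : u a <= j -> g a j.+1 = f a j.+1.
  by move=> uj; apply: (slid_off sl); rewrite /on_path ua in uj *; lia.
have samed i' j : a < i' -> g i' j = f i' j.
  by move=> uj; apply: (slid_off sl); rewrite /on_path; lia.
case: (ltngtP i a) => ia.
- have [d1 d2 d3] := slid_down sl (i := i) ltac:(lia).
  split; [by apply: (slid_mono sl); lia | | lia].
  by move=> j ji; have [] := @slid_right _ _ _ _ _ _ sl i j ltac:(lia) ji.
- have [u1 u2 u3] := gu i ltac:(lia).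
  split=> // [j /u2|]; rewrite -!samed //; lia.
- rewrite {}ia in Ai *.
  have [u1 u2 u3] := gu a (leqnn _); have m := slid_mono sl (i := a) ltac:(lia).
  split; first by rewrite -ua in m; lia.
  + move=> j jv; case: (ltnP j (v a.+1)) => jlt.
      by have [] := @slid_right _ _ _ _ _ _ sl a j ltac:(lia) ltac:(lia).
    by have := u2 j ltac:(lia); rewrite same ?samed // ua.
  + by move: u3; rewrite same ?samed.
Qed.

(** The slide changes nothing to the right of its final cell in row [a], nor below that row. So the
    old forward path, restarted at the final cell, remains one. *)
Lemma fwd_after_slid (f g : grid) x0 A a v u :
  slid f g x0 A a v -> is_fwd f A u -> u A = v A ->
  is_fwd g a (fun i => if i <= a then v a.+1 else u i).
Proof.
move=> sl fu uA i ai /=; have Aa := slid_rows sl.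
have [uv ua] := slid_fwd sl fu uA.
have samed i' j : a < i' -> g i' j = f i' j.
  by move=> uj; apply: (slid_off sl); rewrite /on_path; lia.
have [u1 u2 u3] := fu i ltac:(lia).
case: (ltngtP i a) ai => // [ia|ia] _.
- by split=> // [j /u2|]; rewrite !samed //; lia.
- have same j : v a.+1 <= j -> g a j.+1 = f a j.+1.
    by move=> vj; apply: (slid_off sl); rewrite /on_path; lia.
  rewrite {}ia in u1 u2 u3 *.
  have := uv a ltac:(lia); have := slid_mono sl (i := a) ltac:(lia) => m e.
  split=> //; last by rewrite same ?samed.
  by move=> j jv; rewrite same ?samed; [apply: u2 | |]; lia.
Qed.

(** * Sorted fillings: doing and undoing a slide *)

Lemma sg_le (N M A B : nat) f i j i' j' :
  sorted_grid N M A B f -> i <= i' -> j <= j' -> f i j <= f i' j'.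
Proof.
move=> sf; elim: i' => [|i' IH].
  rewrite leqn0 => /eqP->; elim: j' => [|j' IH]; first by rewrite leqn0 => /eqP->.
  rewrite leq_eqVlt => /orP[/eqP->//|jj]; apply: leq_trans (IH jj) _.
  exact: (sg_row sf).
rewrite leq_eqVlt => /orP[/eqP->{IH}|ii jj]; last first.
  exact: leq_trans (IH ii jj) (sg_col sf _ _).
elim: j' => [|j' IH]; first by rewrite leqn0 => /eqP->.
rewrite leq_eqVlt => /orP[/eqP->//|jj]; apply: leq_trans (IH jj) _.
exact: (sg_row sf).
Qed.

(** This is the dichotomy behind sortedness: a right or lower neighbour of a path cell either is the
    next path cell, whose old entry has moved here, or had an old entry larger than the new one
    here. *)
Lemma slid_path (N M B : nat) f g x0 A a v :
  0 < A -> x0 < N -> sorted_grid N M A.+1 B f -> slid f g x0 A a v -> v A = B ->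
  0 < x0 -> forall i j, on_path A a v i j ->
  [/\ f i j < g i j, g i j <= x0,
      on_path A a v i j.+1 /\ g i j = f i j.+1 \/ g i j < f i j.+1
    & on_path A a v i.+1 j /\ g i j = f i.+1 j \/ g i j < f i.+1 j].
Proof.
move=> A0 xN sf sl vB x1 i j /andP[Ai /andP[vj jv]].
have vle := slid_le sl.
have vB' k : A <= k <= a.+1 -> B <= v k by move=> Ak; rewrite -vB; apply: vle; lia.
have pos i' j' : (A <= i') && (B <= j') -> (i', j') != (A, B) -> 0 < f i' j'.
  move=> /andP[Ai' Bj']; rewrite xpair_eqE lt0n (sg_zero sf); last lia.
  by move=> ne; apply/negP; lia.
have [xe xr xd] := slid_end sl.
have fx : (i, j) != (A, B) -> f i j < x0.
  move=> ne; case: (eqVneq j (v i)) => [ej|nj].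
    have iA : i != A by apply: contra ne => /eqP ei; rewrite ej ei vB.
    have [_ + _] := slid_down sl (i := i.-1) ltac:(lia).
    by rewrite prednK ?ej //; lia.
  have [_ + _] := @slid_right _ _ _ _ _ _ sl i j.-1 Ai ltac:(lia).
  by rewrite prednK //; lia.
have f0 : f A B = 0 by apply/eqP; rewrite (sg_zero sf) //; lia.
have fstrict : (i, j) != (A, B) -> f i j < f i j.+1 /\ f i j < f i.+1 j.
  move=> ne; have p := pos i j ltac:(have := vB' i ltac:(lia); lia) ne.
  by have l := fx ne; split; [apply: (sg_row_lt sf) | apply: (sg_col_lt sf)]; lia.
have pr := pos i j.+1; have pd := pos i.+1 j; have Bi := vB' i ltac:(lia).
case: (ltngtP j (v i.+1)) jv => // [lt|eq] _.
  have [r1 r2 r3] := @slid_right _ _ _ _ _ _ sl i j Ai ltac:(lia).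
  rewrite r3; split; [|lia| left; split=> //; rewrite /on_path; lia | right; lia].
  case: (eqVneq (i, j) (A, B)) => [[-> ->]|ne]; last by case: (fstrict ne).
  by rewrite f0; apply: pos; rewrite ?xpair_eqE; lia.
case: (eqVneq i a) => [ia|nia].
  rewrite eq ia xe; split=> //; try by right.
  case: (eqVneq (i, j) (A, B)) => [[eA eB]|ne].
    by rewrite -ia -eq eA eB f0.
  by rewrite -ia -eq fx.
have [r1 r2 r3] := slid_down sl (i := i) ltac:(lia).
rewrite eq r3 -eq; rewrite -eq in r1 r2.
have := slid_mono sl (i := i.+1) ltac:(lia) => m.
split; [|lia| right; lia | left; split=> //; rewrite /on_path; lia].
case: (eqVneq (i, j) (A, B)) => [[-> ->]|ne]; last by case: (fstrict ne).
by rewrite f0; apply: pos; rewrite ?xpair_eqE; lia.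
Qed.

Lemma slid_sorted (N M B : nat) f g x0 A a v :
  0 < A -> 0 < B <= M -> 0 < x0 < N -> sorted_grid N M A.+1 B f ->
  slid f g x0 A a v -> v A = B -> sorted_grid N M A B g.
Proof.
move=> A0 B0 /andP[x1 xN] sf sl vB; have Aa := slid_rows sl.
have path := slid_path A0 xN sf sl vB x1.
have vB' i : A <= i <= a.+1 -> B <= v i.
  by move=> Ai; rewrite -vB; apply: (slid_le sl); lia.
have off i j : ~~ on_path A a v i j -> g i j = f i j by apply: (slid_off sl).
have row i j : g i j <= f i j.+1 /\ (0 < g i j < N -> g i j < g i j.+1).
  case: (boolP (on_path A a v i j)) => on; case: (boolP (on_path A a v i j.+1)) => on'.
  - by have [p1 p2 p3 p4] := path _ _ on; have [q1 q2 q3 q4] := path _ _ on'; split; lia.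
  - have [p1 p2 p3 p4] := path _ _ on; rewrite (off _ _ on').
    by case: p3 => [[]|p3]; [rewrite (negbTE on')|split; lia].
  - have [q1 q2 q3 q4] := path _ _ on'; rewrite (off _ _ on).
    by have := sg_row sf i j; split; lia.
  - rewrite !off //; split; first exact: sg_row sf i j.
    exact: (sg_row_lt sf).
have col i j : g i j <= f i.+1 j /\ (0 < g i j < N -> g i j < g i.+1 j).
  case: (boolP (on_path A a v i j)) => on; case: (boolP (on_path A a v i.+1 j)) => on'.
  - by have [p1 p2 p3 p4] := path _ _ on; have [q1 q2 q3 q4] := path _ _ on'; split; lia.
  - have [p1 p2 p3 p4] := path _ _ on; rewrite (off _ _ on').
    by case: p4 => [[]|p4]; [rewrite (negbTE on')|split; lia].
  - have [q1 q2 q3 q4] := path _ _ on'; rewrite (off _ _ on).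
    by have := sg_col sf i j; split; lia.
  - rewrite !off //; split; first exact: sg_col sf i j.
    exact: (sg_col_lt sf).
have fg i j : f i j <= g i j.
  case: (boolP (on_path A a v i j)) => [/path[] *|on]; first lia.
  by rewrite off.
split.
- move=> i j; case: (boolP (on_path A a v i j)) => [/path[] *|on]; first lia.
  by rewrite off // (sg_top sf).
- by move=> i j; have [+ _] := row i j; have := fg i j.+1; lia.
- by move=> i j; have [+ _] := col i j; have := fg i.+1 j; lia.
- by move=> i j; have [_] := row i j.
- by move=> i j; have [_] := col i j.
- move=> i j i0; case: (boolP (on_path A a v i j)) => on.
    have [p1 _ _ _] := path _ _ on; case/andP: on => [Ai /andP[vj jv]].
    by have := vB' i ltac:(lia); lia.
  rewrite off // (sg_zero sf) //.
  have : ~~ ((i == A) && (j == B)).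
    apply: contra on => /andP[/eqP-> /eqP->]; rewrite /on_path vB.
    by have := slid_mono sl (i := A); lia.
  by lia.
- move=> j jM; rewrite off ?(sg_row0 sf) //; rewrite /on_path; lia.
- by move=> i j jM; have := fg i j; rewrite (sg_far sf) //;
    case: (boolP (on_path A a v i j)) => [/path[] *|on]; [lia|rewrite off // (sg_far sf)].
Qed.

(** After a step to the right, the left neighbour of the cell reached holds the old entry of that
    cell, which exceeds the entry above it because [f] is sorted. Steps down are symmetric. Hence
    the backward path retraces the slide. *)
Lemma slid_back (N M B : nat) f g x0 A a v :
  0 < A -> 0 < B <= M -> 0 < x0 < N -> sorted_grid N M A.+1 B f ->
  slid f g x0 A a v -> v A = B -> is_back g A a v.
Proof.
move=> A0 B0 /andP[x1 xN] sf sl vB; have Aa := slid_rows sl.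
have path := slid_path A0 xN sf sl vB x1.
have vB' i : A <= i <= a.+1 -> B <= v i.
  by move=> Ai; rewrite -vB; apply: (slid_le sl); lia.
split; first exact: slid_mono sl.
- move=> i j Ai ji; have [r1 r2 r3] := slid_right sl Ai ji; rewrite r3.
  have := vB' i ltac:(lia) => Bi.
  rewrite (slid_off sl); last first.
    apply/negP => /andP[Ai' /andP[]]; rewrite prednK; lia.
  have : f i j.+1 != 0 by rewrite (sg_zero sf); lia.
  have := sg_col sf i.-1 j.+1; have := @sg_col_lt _ _ _ _ _ sf i.-1 j.+1.
  by rewrite prednK; lia.
- move=> i Ai; have [r1 r2 ->] := slid_down sl Ai.
  rewrite (slid_off sl); last by rewrite /on_path; have := vB' i.+1; lia.
  have := vB' i.+1 ltac:(lia) => Bi.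
  have : f i.+1 (v i.+1) != 0 by rewrite (sg_zero sf); lia.
  have := sg_row sf i.+1 (v i.+1).-1; have := @sg_row_lt _ _ _ _ _ sf i.+1 (v i.+1).-1.
  by rewrite prednK; lia.
Qed.

(** Every path cell takes back the entry of its predecessor. The value 0 marks the starting cell as
    unprocessed again; the entry that belongs there is the one found in the final cell. *)
Definition unslide (A B a : nat) (v : nat -> nat) (g : grid) : grid := fun i j =>
  if on_path A a v i j then
    if (i == A) && (j == B) then 0 else if v i < j then g i j.-1 else g i.-1 j
  else g i j.

(** A backward path always brings in the larger of the left and upper neighbours. This keeps the
    filling sorted, and it makes the moved entry the smaller one when the slide is carried out
    again. *)
Lemma unslide_slid (N M B : nat) g A a v :
  0 < A <= a -> 0 < B <= M -> sorted_grid N M A B g -> is_back g A a v -> v A = B ->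
  g a (v a.+1) < N ->
  let f := unslide A B a v g in
  slid f g (g a (v a.+1)) A a v /\ sorted_grid N M A.+1 B f.
Proof.
move=> /andP[A0 Aa] B0 sg gv vB xN f.
have vle := back_le gv.
have vB' i : A <= i <= a.+1 -> B <= v i by move=> Ai; rewrite -vB; apply: vle; lia.
have off i j : ~~ on_path A a v i j -> f i j = g i j by rewrite /f /unslide => /negbTE->.
have onB i j : on_path A a v i j -> [/\ A <= i, i <= a, B <= j & j <= v a.+1].
  move=> /andP[Ai /andP[vj jv]]; split; [lia|lia| |].
    by have := vB' i ltac:(lia); lia.
  by apply: leq_trans jv _; apply: vle; lia.
have gpos i j : A <= i -> B <= j -> 0 < g i j.
  by move=> Ai Bj; rewrite lt0n (sg_zero sg); lia.
have onN i j : on_path A a v i j -> g i j <= g a (v a.+1).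
  by move=> /onB[*]; apply: (sg_le sg).
have fstart : f A B = 0.
  by rewrite /f /unslide !eqxx /=; case: ifP => // /negP[]; rewrite /on_path vB;
    have := back_mono gv (i := A); lia.
have path i j : on_path A a v i j ->
    [/\ f i j < g i j, g i j.-1 <= f i j, g i.-1 j <= f i j
      & (on_path A a v i j.-1 \/ g i j.-1 < f i j \/ g i j.-1 = 0)
        /\ (on_path A a v i.-1 j \/ g i.-1 j < f i j \/ g i.-1 j = 0)].
  move=> on; have [Ai ia Bj jb] := onB _ _ on; have gp := gpos _ _ Ai Bj.
  case: (eqVneq (i, j) (A, B)) => [[-> ->]|ne].
    have z1 : g A B.-1 = 0 by apply/eqP; rewrite (sg_zero sg); lia.
    have z2 : g A.-1 B = 0.
      case: (posnP A.-1) => [->|A1]; first by rewrite (sg_row0 sg); lia.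
      by apply/eqP; rewrite (sg_zero sg); lia.
    by rewrite fstart z1 z2; split; auto; apply: gpos.
  have -> : f i j = if v i < j then g i j.-1 else g i.-1 j.
    by rewrite /f /unslide on; rewrite xpair_eqE in ne; rewrite (negbTE ne).
  case/andP: (on) => _ /andP[vj jv].
  have := sg_row sg i j.-1; have := @sg_row_lt _ _ _ _ _ sg i j.-1.
  have := sg_col sg i.-1 j; have := @sg_col_lt _ _ _ _ _ sg i.-1 j.
  rewrite !prednK; [|lia|lia] => c1 c2 r1 r2.
  have gN := onN _ _ on.
  case: ifPn => vj'.
    have := @back_right _ _ _ _ gv i j.-1 ltac:(lia) ltac:(lia).
    rewrite prednK; last lia.
    move=> h; split; [|lia|lia|split; [left; rewrite /on_path; lia|lia]].
    by have := gpos i j.-1 Ai ltac:(have := vB' i; lia); lia.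
  have ej : j = v i by lia.
  have iA : A < i by rewrite xpair_eqE in ne; case: (eqVneq i A) ne ej => [->|]; lia.
  have := back_down gv (i := i.-1) ltac:(lia).
  rewrite !(prednK (n := i)) -?ej; last lia.
  move=> h; split; [|lia|lia|split; [lia|left; rewrite /on_path]].
    by have := gpos i.-1 j ltac:(lia) Bj; lia.
  by have := back_mono gv (i := i.-1) ltac:(lia); rewrite !prednK -?ej; lia.
have fg i j : f i j <= g i j.
  by case: (boolP (on_path A a v i j)) => [/path[] *|/off->//]; lia.
have rowf i j : f i j <= f i j.+1 /\ (0 < f i j < N -> f i j < f i j.+1).
  case: (boolP (on_path A a v i j)) => on; case: (boolP (on_path A a v i j.+1)) => on'.
  - by have [p1 p2 p3 p4] := path _ _ on; have [q1 q2 q3 q4] := path _ _ on';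
      rewrite /= in q2; split; lia.
  - have [p1 p2 p3 p4] := path _ _ on; rewrite (off _ _ on').
    by have := sg_row sg i j; split; lia.
  - have [q1 q2 q3 [+ _]] := path _ _ on'; rewrite (off _ _ on) /= in q2 *.
    by rewrite (negbTE on); move=> [//|]; split; lia.
  - rewrite !off //; split; first exact: sg_row sg i j.
    exact: (sg_row_lt sg).
have colf i j : f i j <= f i.+1 j /\ (0 < f i j < N -> f i j < f i.+1 j).
  case: (boolP (on_path A a v i j)) => on; case: (boolP (on_path A a v i.+1 j)) => on'.
  - by have [p1 p2 p3 p4] := path _ _ on; have [q1 q2 q3 q4] := path _ _ on';
      rewrite /= in q3; split; lia.
  - have [p1 p2 p3 p4] := path _ _ on; rewrite (off _ _ on').
    by have := sg_col sg i j; split; lia.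
  - have [q1 q2 q3 [_ +]] := path _ _ on'; rewrite (off _ _ on) /= in q3 *.
    by rewrite (negbTE on); move=> [//|]; split; lia.
  - rewrite !off //; split; first exact: sg_col sg i j.
    exact: (sg_col_lt sg).
split; last first.
  split=> //.
  - by move=> i j; apply: leq_trans (fg i j) (sg_top sg i j).
  - by move=> i j; case: (rowf i j).
  - by move=> i j; case: (colf i j).
  - by move=> i j; case: (rowf i j).
  - by move=> i j; case: (colf i j).
  - move=> i j i0; case: (eqVneq (i, j) (A, B)) => [[-> ->]|ne].
      by rewrite fstart; lia.
    case: (boolP (on_path A a v i j)) => on; last first.
      by rewrite off // (sg_zero sg) //; rewrite xpair_eqE in ne; lia.
    have [Ai ia Bj jb] := onB _ _ on.
    suff : 0 < f i j by rewrite xpair_eqE in ne; lia.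
    rewrite /f /unslide on; rewrite xpair_eqE in ne; rewrite (negbTE ne).
    case/andP: on => _ /andP[vj jv]; case: ifPn => vj'.
      by apply: gpos => //; have := vB' i; lia.
    apply: gpos => //; case: (eqVneq i A) ne vj vj' => [->|]; lia.
  - by move=> j jM; have := fg 0 j; rewrite (sg_row0 sg) //; lia.
  - move=> i j jM; case: (boolP (on_path A a v i j)) => on; last by rewrite off ?(sg_far sg).
    by have := onN _ _ on; rewrite (sg_far sg) //; lia.
split=> //.
- exact: back_mono gv.
- move=> i j Ai ji; have := vB' i ltac:(lia) => Bi.
  have e : f i j.+1 = g i j.
    rewrite /f /unslide /on_path Ai.
    have -> : v i <= j.+1 <= v i.+1 by lia.
    have -> : (i == A) && (j.+1 == B) = false by lia.
    by have -> : v i < j.+1 by lia.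
  have on' : on_path A a v i j.+1 by rewrite /on_path; lia.
  have gp := gpos i j ltac:(lia) ltac:(lia).
  have l1 : g i j < g i j.+1 by have [+ _ _ _] := path _ _ on'; rewrite e.
  have l2 := onN _ _ on'.
  split=> //; last by rewrite e; lia.
  rewrite e off; last by rewrite /on_path; lia.
  by apply: (sg_col_lt sg); lia.
- move=> i Ai; have := vB' i.+1 ltac:(lia) => Bi; set j := v i.+1 in Bi *.
  have m := back_mono gv (i := i) ltac:(lia); have m' := back_mono gv (i := i.+1) ltac:(lia).
  have e : f i.+1 j = g i j.
    rewrite /f /unslide /on_path; case: ifP => [_|/negP[]]; last by rewrite /j; lia.
    have -> : (i.+1 == A) = false by lia.
    by rewrite ltnn.
  have on' : on_path A a v i.+1 j by rewrite /on_path /j; lia.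
  have gp := gpos i j ltac:(lia) ltac:(lia).
  have l1 : g i j < g i.+1 j by have [+ _ _ _] := path _ _ on'; rewrite e.
  have l2 := onN _ _ on'.
  split=> //; last by rewrite e; lia.
  rewrite e off; last by rewrite /on_path /j; lia.
  by apply: (sg_row_lt sg); lia.
- have := vB' a.+1 ltac:(lia) => Bb.
  have gp := gpos a (v a.+1) ltac:(lia) ltac:(lia).
  split=> //; rewrite off; try by rewrite /on_path; lia.
    by apply: (sg_row_lt sg); lia.
  by apply: (sg_col_lt sg); lia.
- by move=> i j /off->.
Qed.

(** * Recovering the final cell from the hooks *)

(** In terms of candidates: above the final cell, the candidate of row [i.+1] moves up one row and
    left one column; the final cell becomes the candidate of row [a]; the candidates below it
    stay. *)
Definition hook_step (B A a c b : nat) (J J' : nat -> int) : Prop :=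
  [/\ forall i, A <= i < a -> J' i = (J i.+1 - 1)%R,
      J' a = (b%:Z - B%:Z)%R
    & forall i, a < i <= c -> J' i = J i].

(* [(i, B + J i)] is the candidate final cell recorded in row [i]; when [J i < 0] it
   lies left of the processed column and the bound below is vacuous. *)
Definition below_path (B A c : nat) (J : nat -> int) (u : nat -> nat) : Prop :=
  forall i, A <= i <= c -> (B%:Z + J i <= (u i)%:Z)%R.

(** The new forward path [w] starts just above the slide path and cannot cross it as a backward
    path, so [v i.+1 <= w i]. This covers the rows up to [a]. Below, [w] stays weakly right of the
    old forward path, and the candidates are the old ones. *)
Lemma below_path_step (f g : grid) x0 A a c B v J J' w u :
  0 < A -> a <= c -> slid f g x0 A a v -> is_back g A a v -> v A = B ->
  hook_step B A a c (v a.+1) J J' ->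
  is_fwd f A u -> u A = B -> below_path B A.+1 c J u ->
  is_fwd g A.-1 w -> w A.-1 = B -> below_path B A c J' w.
Proof.
move=> A0 ac sl gv vB [s1 s2 s3] fu uB Ju gw wB; have Aa := slid_rows sl.
have [uv ua] : (forall i, A <= i <= a -> u i = v i) /\ v a.+1 <= u a.+1.
  by apply: (slid_fwd sl fu); rewrite uB.
have vw i : A.-1 <= i <= a -> v i.+1 <= w i.
  by move=> Ai; apply: (fwd_above_back gv gw); rewrite ?prednK ?vB ?wB.
move=> i Ai; case: (ltngtP i a) => ia.
- have := s1 i ltac:(lia); have := Ju i.+1 ltac:(lia); have := vw i ltac:(lia).
  have := uv i.+1 ltac:(lia); lia.
- rewrite s3; last lia.
  have gu := fwd_after_slid sl fu ltac:(congruence).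
  have gw' : is_fwd g a w by move=> k ka; apply: gw; lia.
  have := @fwd_compare _ _ _ _ _ gw' gu; rewrite leqnn.
  move=> /(_ (vw a ltac:(lia)) ltac:(done) ltac:(done) i ltac:(lia)) /=.
  by have := Ju i ltac:(lia); rewrite (leqNgt i a) ia /=; lia.
- by rewrite ia s2; have := vw a ltac:(lia); lia.
Qed.

(** Suppose the first final cell lies in a higher row than the second. As a candidate above the
    second one, it is strictly left of the second backward path. Its forward path then stays
    strictly left of that path down to row [b2], so the second final cell is not weakly below it, a
    contradiction. *)
Lemma endpoint_unique (f1 f2 g : grid) x1 x2 A a1 a2 c B v1 v2 J1 J2 J' u1 u2 :
  slid f1 g x1 A a1 v1 -> slid f2 g x2 A a2 v2 ->
  is_back g A a1 v1 -> is_back g A a2 v2 -> v1 A = B -> v2 A = B ->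
  a1 <= c -> a2 <= c ->
  hook_step B A a1 c (v1 a1.+1) J1 J' -> hook_step B A a2 c (v2 a2.+1) J2 J' ->
  is_fwd f1 A u1 -> u1 A = B -> below_path B A.+1 c J1 u1 ->
  is_fwd f2 A u2 -> u2 A = B -> below_path B A.+1 c J2 u2 ->
  a1 = a2 /\ v1 a1.+1 = v2 a2.+1.
Proof.
have key f1' f2' y1 y2 b1 b2 w1 w2 K1 K2 z1 z2 :
    slid f1' g y1 A b1 w1 -> slid f2' g y2 A b2 w2 -> is_back g A b2 w2 ->
    w1 A = B -> w2 A = B -> b2 <= c ->
    hook_step B A b1 c (w1 b1.+1) K1 J' -> hook_step B A b2 c (w2 b2.+1) K2 J' ->
    is_fwd f1' A z1 -> z1 A = B -> below_path B A.+1 c K1 z1 ->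
    is_fwd f2' A z2 -> z2 A = B -> below_path B A.+1 c K2 z2 -> b2 <= b1.
  move=> s1 s2 k2 e1 e2 bc [h1 h1' h1''] [h2 h2' h2''] F1 E1 I1 F2 E2 I2.
  rewrite leqNgt; apply/negP => lt.
  have [zw1 _] := slid_fwd s1 F1 ltac:(congruence).
  have [zw2 _] := slid_fwd s2 F2 ltac:(congruence).
  have r1 := slid_rows s1; have r2 := slid_rows s2.
  have G1 := fwd_after_slid s1 F1 ltac:(congruence).
  have := fwd_below_back k2 G1 r1; rewrite leqnn => /(_ _ b2); rewrite lt leqnn.
  have lt' : w1 b1.+1 < w2 b1.+1.
    have := h2 b1 ltac:(lia); have := I2 b1.+1 ltac:(lia).
    by have := zw2 b1.+1 ltac:(lia); lia.
  move=> /(_ lt' isT); rewrite (leqNgt b2 b1) lt /=.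
  have := I1 b2 ltac:(lia); have := h1'' b2 ltac:(lia).
  have := slid_mono s2 (i := b2) ltac:(lia).
  lia.
move=> s1 s2 k1 k2 e1 e2 c1 c2 h1 h2 F1 E1 I1 F2 E2 I2.
have a12 : a1 = a2.
  apply/eqP; rewrite eqn_leq; apply/andP; split.
    exact: key s2 s1 k1 e2 e1 c1 h2 h1 F2 E2 I2 F1 E1 I1.
  exact: key s1 s2 k2 e1 e2 c2 h1 h2 F1 E1 I1 F2 E2 I2.
split=> //; case: h1 => _ h1 _; case: h2 => _ h2 _; rewrite a12 in h1 *; lia.
Qed.

(** The forward path [w] of the cell above [(A, B)] acts as a barrier: starting weakly below it, a
    backward path cannot climb past row [A] and must end at [(A, B)]. The proof is by induction on
    [i + j]. *)
Lemma back_exists (N M A B : nat) (g : grid) w :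
  0 < A -> 0 < B <= M -> sorted_grid N M A B g ->
  (forall i j, 0 < g i j.+1 < N -> g i j.+1 <> g i.+1 j) ->
  is_fwd g A.-1 w -> w A.-1 = B ->
  forall i j, A <= i -> B <= j <= w i -> g i j < N ->
  exists v, [/\ is_back g A i v, v A = B & v i.+1 = j].
Proof.
move=> A0 B0 sg gd gw wB i j.
move: {2}(i + j).+1 (ltnSn (i + j)) => s; elim: s i j => [//|s IH] i j ijs Ai Bj gN.
have [w1 w2 w3] := gw i.-1 ltac:(lia).
rewrite prednK in w1 w2 w3; last lia.
have low i' j' : A <= i' -> B <= j' -> 0 < g i' j'.
  by move=> *; rewrite lt0n (sg_zero sg); lia.
have left : B < j -> g i.-1 j < g i j.-1 ->
    exists v, [/\ is_back g A i v, v A = B & v i.+1 = j].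
  move=> Bj' lt.
  have [||||v [kv vA vi]] := IH i j.-1; [lia|lia|lia| |].
    by have := sg_row sg i j.-1; rewrite prednK; lia.
  (* The path to [(i, j.-1)] is prolonged by one step to the right, which changes only the column
     where it leaves row [i]. *)
  exists (fun k => if k <= i then v k else j); split=> [||]; rewrite ?Ai ?ltnn //.
  split=> k.
  - move=> Ak; have := back_mono kv Ak.
    have -> : k <= i by lia.
    case: (eqVneq k i) => [->|ki]; first by rewrite ltnn vi; lia.
    by have -> : k < i by lia.
  - move=> l Ak; have -> : k <= i by lia.
    case: (ltnP k i) => [ki|ki]; first by apply: (back_right kv).
    have -> : k = i by lia.
    case: (eqVneq l j.-1) => [->|lj] jl; first by rewrite prednK; lia.
    by apply: (back_right kv); lia.
  - move=> Ak; have -> : k < i by lia.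
    by apply: (back_down kv).
have up : A < i -> g i j.-1 < g i.-1 j ->
    exists v, [/\ is_back g A i v, v A = B & v i.+1 = j].
  move=> Ai' lt.
  have jw : j <= w i.-1.
    rewrite leqNgt; apply/negP => wj.
    by have := w2 j.-1 ltac:(lia); rewrite prednK; lia.
  have [||||v [kv vA vi]] := IH i.-1 j; [lia|lia|lia| |].
    by have := sg_col sg i.-1 j; rewrite prednK; lia.
  rewrite prednK in vi; last lia.
  exists (fun k => if k <= i then v k else j); split=> [||]; rewrite ?Ai ?ltnn //.
  split=> k.
  - move=> Ak; have -> : k <= i by lia.
    case: (eqVneq k i) => [->|ki]; first by rewrite ltnn vi.
    have -> : k < i by lia.
    by apply: (back_mono kv); lia.
  - move=> l Ak; have -> : k <= i by lia.
    case: (ltnP k i) => [ki|ki]; first by apply: (back_right kv); lia.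
    have -> : k = i by lia.
    by rewrite vi; lia.
  - move=> Ak; have -> : k < i by lia.
    case: (eqVneq k i.-1) => [->|ki]; last by apply: (back_down kv); lia.
    by rewrite prednK ?vi //; lia.
have pB : 0 < j by lia.
case: (ltngtP (g i.-1 j) (g i j.-1)) => [lt|lt|eq].
- apply: left => //; rewrite ltn_neqAle; apply/andP; split; last lia.
  apply/eqP => eB; suff : g i j.-1 = 0 by lia.
  by apply/eqP; rewrite (sg_zero sg); lia.
- apply: up => //; rewrite ltn_neqAle; apply/andP; split; last lia.
  (* In row [A] no step up is possible: right of column [B] it would contradict the steps of [w],
     and in column [B] the cell above holds 0. *)
  apply/eqP => eA; suff : g i.-1 j = 0 by lia.
  have jB : j = B.
    suff : w i.-1 = B by move=> e; apply/eqP; rewrite eqn_leq; apply/andP; split; [|lia];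
      rewrite leqNgt; apply/negP => lt'; have := w2 j.-1 ltac:(lia); rewrite prednK; lia.
    by rewrite -eA wB.
  rewrite jB; case: (posnP i.-1) => [->|i1]; first by rewrite (sg_row0 sg); lia.
  by apply/eqP; rewrite (sg_zero sg); lia.
(* By distinctness the two entries can be equal only if both are 0, so the path has arrived at
   [(A, B)]. *)
- have z : g i.-1 j = 0.
    apply/eqP; rewrite -leqn0 leqNgt; apply/negP => p.
    have := gd i.-1 j.-1; rewrite !prednK //; last lia.
    have := sg_col sg i.-1 j; rewrite prednK; last lia.
    by move=> h; apply; lia.
  have jB : j = B.
    apply/eqP; rewrite eqn_leq; apply/andP; split; last lia.
    rewrite leqNgt; apply/negP => lt.
    by have := low i j.-1 Ai ltac:(lia); lia.
  have iA : i = A.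
    apply/eqP; rewrite eqn_leq; apply/andP; split; last lia.
    rewrite leqNgt; apply/negP => lt.
    by have := low i.-1 j ltac:(lia) ltac:(lia); lia.
  exists (fun _ => B); split=> //; rewrite iA; split=> k //; last lia.
  by move=> l _; lia.
Qed.

(** The candidates are examined from row [c] upwards. The current choice is kept while the next
    candidate is strictly left of its backward path, and is replaced by that candidate otherwise.
    Row [c] can serve as the first choice because [J c] is nonnegative. *)
Lemma endpoint_exists (N M A B c : nat) (g : grid) (J : nat -> int) w :
  0 < A <= c -> 0 < B <= M -> sorted_grid N M A B g ->
  (forall i j, 0 < g i j.+1 < N -> g i j.+1 <> g i.+1 j) ->
  is_fwd g A.-1 w -> w A.-1 = B -> below_path B A c J w ->
  (forall i j, A <= i <= c -> (j%:Z = B%:Z + J i)%R -> B <= j -> g i j < N) ->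
  (0 <= J c)%R ->
  exists a v u,
  [/\ A <= a <= c, is_back g A a v /\ v A = B, ((v a.+1)%:Z = B%:Z + J a)%R,
      is_fwd g a u /\ u a = v a.+1
    & (forall i, A <= i < a -> (B%:Z + J i < (v i.+1)%:Z)%R) /\ below_path B a.+1 c J u].
Proof.
move=> /andP[A0 Ac] B0 sg gd gw wB Jw JN Jc.
have good i : A <= i <= c -> (0 <= J i)%R -> exists v u,
    [/\ is_back g A i v /\ v A = B, ((v i.+1)%:Z = B%:Z + J i)%R
      & is_fwd g i u /\ u i = v i.+1].
  move=> Ai Ji; have Jwi := Jw i Ai.
  pose j := absz (B%:Z + J i)%R; have ej : (j%:Z = B%:Z + J i)%R by rewrite /j; lia.
  have [v [kv vA vi]] := back_exists A0 B0 sg gd gw wB (i := i) (j := j)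
    ltac:(lia) ltac:(lia) (JN i j Ai ej ltac:(lia)).
  have [u ui gu] := fwd_exists i j (sg_top sg) (sg_far sg).
  by exists v, u; split=> //; rewrite vi // ui.
suff sel d : d <= c - A -> let r := c - d in exists a v u,
  [/\ r <= a <= c, is_back g A a v /\ v A = B, ((v a.+1)%:Z = B%:Z + J a)%R,
      is_fwd g a u /\ u a = v a.+1
    & (forall i, r <= i < a -> (B%:Z + J i < (v i.+1)%:Z)%R) /\ below_path B a.+1 c J u].
  by have := sel (c - A) (leqnn _); rewrite /= subKn.
elim: d => [|d IH] dc /=.
  rewrite subn0; have [v [u [kv vi gu]]] := good c ltac:(lia) Jc.
  exists c, v, u; split=> //; first by rewrite leqnn.
  by split=> i; lia.
have [a [v [u [rac [kv vA] va [gu ua] [lo hi]]]]] := IH ltac:(lia).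
set r := c - d.+1; have er : c - d = r.+1 by rewrite /r; lia.
rewrite {}er in rac lo.
case: (Order.TotalTheory.ltP (B%:Z + J r)%R (v r.+1)%:Z%R) => [lt|ge].
  exists a, v, u; split=> //; first lia.
  split=> // i ri; case: (eqVneq i r) => [->//|ir]; apply: lo; lia.
have vr : B <= v r.+1 by rewrite -vA; apply: (back_le kv); rewrite /r; lia.
have [v' [u' [[kv' vA'] vi' [gu' ui']]]] := good r ltac:(rewrite /r; lia) ltac:(lia).
exists r, v', u'; split=> //; first by rewrite /r; lia.
split=> i; first lia.
(* The forward path of the new choice stays weakly right of the old backward path. So the candidates
   that were strictly left of the latter are weakly below the former, and from row [a] on the two
   forward paths are compared. *)
have cmp := fwd_above_back kv gu' ltac:(rewrite /r; lia) ltac:(lia).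
move=> ri; case: (ltngtP i a) => ia.
- by have := lo i ltac:(lia); have := cmp i ltac:(lia); lia.
- have gu2 : is_fwd g a u' by move=> k ka; apply: gu'; lia.
  have := fwd_compare gu2 gu; rewrite ua => /(_ (cmp a ltac:(lia))).
  move=> /(_ ltac:(done) ltac:(done) i ltac:(lia)).
  by have := hi i ltac:(lia); lia.
- by rewrite ia; have := cmp a ltac:(lia); lia.
Qed.

(** * Slides, fillings and cells *)

Lemma slid_nil (f : grid) P Q :
  f P Q < f P Q.+1 -> f P Q < f P.+1 Q -> slid f f (f P Q) P P (fun=> Q).
Proof. by move=> fr fd; split=> //; lia. Qed.

(** [f1] is the filling after the first exchange. Its value at [(P, Q.+1)] is left free, since
    [slid] ignores the entry of the starting cell. *)
Lemma slid_cons_right (f f1 g : grid) x0 P Q a v :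
  (forall i j, (i, j) != (P, Q) -> (i, j) != (P, Q.+1) -> f1 i j = f i j) ->
  f1 P Q = f P Q.+1 -> f P Q.+1 < f P.+1 Q -> f P Q.+1 < x0 ->
  slid f1 g x0 P a v -> v P = Q.+1 ->
  slid f g x0 P a (fun i => if i == P then Q else v i).
Proof.
move=> ef eP l1 l2 sl vP; have Pa := slid_rows sl.
have vle := slid_le sl; have vP' i : P <= i <= a.+1 -> Q < v i.
  by move=> Pi; rewrite -vP; apply: vle; lia.
have ef' i j : P <= i -> (P < i) || (Q.+1 < j) -> f1 i j = f i j.
  by move=> Pi ij; apply: ef; rewrite xpair_eqE; lia.
split=> //.
- move=> i Pi; have := slid_mono sl Pi; have := vP' i.+1 ltac:(lia).
  by have -> : (i.+1 == P) = false by [lia]; case: eqP => [->|]; lia.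
- move=> i j Pi; have -> : (i.+1 == P) = false by lia.
  case: eqP => [->|ne] ij; last first.
    by have [] := slid_right sl Pi ij; have := vP' i ltac:(lia); rewrite !ef' //; lia.
  case: (eqVneq j Q) => [->|jQ].
    split=> //; rewrite (slid_off sl) //; rewrite /on_path; lia.
  have [] := @slid_right _ _ _ _ _ _ sl P j ltac:(lia) ltac:(lia).
  by rewrite !ef' //; lia.
- move=> i Pi; have -> : (i.+1 == P) = false by lia.
  have l := vP' i.+1 ltac:(lia); have [] := slid_down sl Pi.
  by rewrite !ef' //; lia.
- have -> : (a.+1 == P) = false by lia.
  have l := vP' a.+1 ltac:(lia); have [] := slid_end sl.
  by rewrite !ef' //; lia.
- move=> i j off; have nP : (P.+1 == P) = false by lia.
  have offv : ~~ on_path P a v i j.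
    apply: contra off => /andP[Pi ij]; rewrite /on_path Pi /=.
    have -> : (i.+1 == P) = false by lia.
    by case: (eqVneq i P) ij => [->|//]; rewrite vP; lia.
  have vP1 := vP' P.+1 ltac:(lia).
  rewrite (slid_off sl offv); apply: ef; rewrite xpair_eqE;
    by apply: contra off => /andP[/eqP-> /eqP->]; rewrite /on_path eqxx nP; lia.
Qed.

Lemma slid_cons_down (f f1 g : grid) x0 P Q a v :
  (forall i j, (i, j) != (P, Q) -> (i, j) != (P.+1, Q) -> f1 i j = f i j) ->
  f1 P Q = f P.+1 Q -> f P.+1 Q < f P Q.+1 -> f P.+1 Q < x0 ->
  slid f1 g x0 P.+1 a v -> v P.+1 = Q ->
  slid f g x0 P a (fun i => if i == P then Q else v i).
Proof.
move=> ef eP l1 l2 sl vP; have Pa := slid_rows sl.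
have vle := slid_le sl; have vP' i : P < i <= a.+1 -> Q <= v i.
  by move=> Pi; rewrite -vP; apply: vle; lia.
have ef' i j : P < i -> (P.+1 < i) || (Q < j) -> f1 i j = f i j.
  by move=> Pi ij; apply: ef; rewrite xpair_eqE; lia.
split=> //; first lia.
- move=> i Pi; have -> : (i.+1 == P) = false by lia.
  case: eqP => [->|ne]; first by rewrite vP.
  by apply: (slid_mono sl); lia.
- move=> i j Pi; have -> : (i.+1 == P) = false by lia.
  case: eqP => [->|ne] ij; first by rewrite vP in ij; lia.
  have l := vP' i ltac:(lia); have [] := @slid_right _ _ _ _ _ _ sl i j ltac:(lia) ij.
  by rewrite !ef' //; lia.
- move=> i Pi; have -> : (i.+1 == P) = false by lia.
  case: (eqVneq i P) => [->|ne].
    rewrite vP; split=> //; rewrite (slid_off sl) //; rewrite /on_path; lia.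
  have l := vP' i.+1 ltac:(lia); have [] := slid_down sl (i := i) ltac:(lia).
  by rewrite !ef' //; lia.
- have -> : (a.+1 == P) = false by lia.
  have l := vP' a.+1 ltac:(lia); have [] := slid_end sl.
  by rewrite !ef' //; lia.
- move=> i j off; have nP : (P.+1 == P) = false by lia.
  have offv : ~~ on_path P.+1 a v i j.
    apply: contra off => /andP[Pi ij]; rewrite /on_path.
    have -> : (i.+1 == P) = false by lia.
    by case: (eqVneq i P) Pi => [->|_]; lia.
  have vP1 := slid_mono sl (i := P.+1) ltac:(lia).
  rewrite (slid_off sl offv); apply: ef; rewrite xpair_eqE;
    apply: contra off => /andP[/eqP-> /eqP->]; rewrite /on_path ?eqxx nP ?vP; first by lia.
  by have -> : (P.+2 == P) = false by [lia]; rewrite -vP; lia.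
Qed.

(** A slide reads and writes only cells weakly right of and below its start. This allows a passage
    from a whole filling to its processed part. *)
Lemma slid_mask (f g f' g' : grid) x0 A a v :
  slid f g x0 A a v ->
  (forall i j, A <= i -> v A <= j -> (i, j) != (A, v A) -> f' i j = f i j) ->
  (forall i j, A <= i -> v A <= j -> g' i j = g i j) ->
  (forall i j, ~~ ((A <= i) && (v A <= j)) -> g' i j = f' i j) ->
  slid f' g' x0 A a v.
Proof.
move=> sl ef eg egf; have Aa := slid_rows sl.
have vA i : A <= i <= a.+1 -> v A <= v i by move=> Ai; apply: (slid_le sl); lia.
have ef' i j : A <= i -> v A <= j -> (A < i) || (v A < j) -> f' i j = f i j.
  by move=> Ai Aj ne; apply: ef => //; rewrite xpair_eqE; lia.
split=> //.
- exact: slid_mono sl.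
- move=> i j Ai ij; have [] := slid_right sl Ai ij; have := vA i ltac:(lia).
  by move=> l; rewrite !ef' ?eg //; lia.
- move=> i Ai; have [] := slid_down sl Ai; have := vA i.+1 ltac:(lia).
  by move=> l; rewrite !ef' ?eg //; lia.
- have [] := slid_end sl; have := vA a.+1 ltac:(lia).
  by move=> l; rewrite !ef' ?eg //; lia.
- move=> i j off; case: (boolP ((A <= i) && (v A <= j))) => [/andP[Ai Aj]|]; last exact: egf.
  rewrite eg // (slid_off sl) // ef' //.
  case: (ltngtP A i) Ai off => // <- _; case: (ltngtP (v A) j) Aj => // <- _.
  by rewrite /on_path; have := slid_mono sl (i := A); lia.
Qed.

(** * Fillings as lists of rows *)

Lemma getT_setT (X : Type) (d : X) T x v y :
  getT d (Defs.setT d T x v) y = if y == x then v else getT d T y.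
Proof.
case: x y => [i j] [i' j'].
rewrite /getT /Defs.setT nth_set_nth /= xpair_eqE.
by case: (eqVneq i' i) => [->|] //=; rewrite nth_set_nth.
Qed.

Lemma map_size_setT (X : Type) (d : X) T x v la :
  map size T = la -> in_diag la x -> map size (Defs.setT d T x v) = la.
Proof.
case: x => i j eT; rewrite /in_diag /= => /andP[ix jx].
have iT : i < size T by rewrite -(size_map size) eT.
rewrite -eT (nth_map [::]) // in jx.
apply: (@eq_from_nth _ 0) => [|k]; rewrite size_map size_set_nth (maxn_idPr iT).
  by rewrite -eT size_map.
move=> kT; rewrite (nth_map [::]) ?size_set_nth ?(maxn_idPr iT) // nth_set_nth /=.
case: (eqVneq k i) => [->|ki]; last by rewrite -eT (nth_map [::]).
by rewrite size_set_nth (maxn_idPr jx) -eT (nth_map [::]).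
Qed.

Lemma getT_ext (X : Type) (d : X) T T' la :
  map size T = la -> map size T' = la ->
  (forall x, in_diag la x -> getT d T x = getT d T' x) -> T = T'.
Proof.
move=> eT eT' e; have sT : size T = size la by rewrite -eT size_map.
have sT' : size T' = size la by rewrite -eT' size_map.
apply: (@eq_from_nth _ [::]) => [|i iT]; first by rewrite sT sT'.
have iT' : i < size T' by rewrite sT' -sT.
have s : size (nth [::] T i) = nth 0 la i by rewrite -eT (nth_map [::]).
have s' : size (nth [::] T' i) = nth 0 la i by rewrite -eT' (nth_map [::]).
apply: (@eq_from_nth _ d) => [|j jT]; first by rewrite s s'.
by apply: (e (i, j)); rewrite /in_diag /= -sT iT -s.
Qed.

Definition tabulate (X : Type) (la : seq nat) (F : cell -> X) : seq (seq X) :=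
  [seq [seq F (i, j) | j <- iota 0 (nth 0 la i)] | i <- iota 0 (size la)].

Lemma map_size_tabulate (X : Type) la (F : cell -> X) : map size (tabulate la F) = la.
Proof.
apply: (@eq_from_nth _ 0) => [|i]; rewrite !size_map size_iota // => il.
by rewrite /tabulate -map_comp (nth_map 0) ?size_iota //= size_map size_iota nth_iota.
Qed.

Lemma getT_tabulate (X : Type) (d : X) la (F : cell -> X) x :
  in_diag la x -> getT d (tabulate la F) x = F x.
Proof.
case: x => i j /andP[/= ix jx].
by rewrite /getT /= (nth_map 0) ?size_iota // (nth_map 0) nth_iota ?size_iota // nth_iota.
Qed.

(** This is the order in which [flatten] reads a filling, by rows, whereas [cells] goes by
    columns. *)
Definition row_cells (la : seq nat) : seq cell :=
  flatten [seq [seq (i, j) | j <- iota 0 (nth 0 la i)] | i <- iota 0 (size la)].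

Lemma mem_row_cells la x : (x \in row_cells la) = in_diag la x.
Proof.
case: x => i j; apply/flattenP/idP => [[s /mapP[k]]|/andP[/= ix jx]].
  rewrite mem_iota /= add0n => kl -> /mapP[l]; rewrite mem_iota => /= ll [-> ->].
  by rewrite /in_diag /= kl.
exists [seq (i, j) | j <- iota 0 (nth 0 la i)]; apply/mapP.
  by exists i; rewrite ?mem_iota.
by exists j; rewrite ?mem_iota.
Qed.

Lemma uniq_pairs (s : seq nat) (t : nat -> seq nat) :
  uniq s -> (forall i, uniq (t i)) -> uniq (flatten [seq [seq (i, j) | j <- t i] | i <- s]).
Proof.
move=> us ut; elim: s us => [//|i s IH] /= /andP[is_ us].
rewrite cat_uniq IH // andbT map_inj_uniq ?ut => [|j j' [] //].
apply/hasPn => -[i' j'] /flattenP[r /mapP[k ks ->]] /mapP[l _ [-> _]].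
by apply/negP => /mapP[l' _ [e _]]; rewrite -e ks in is_.
Qed.

Lemma uniq_row_cells la : uniq (row_cells la).
Proof. by apply: uniq_pairs => [|i]; apply: iota_uniq. Qed.

Lemma flatten_row_cells la T : map size T = la ->
  flatten T = [seq get T x | x <- row_cells la].
Proof.
move=> eT; rewrite map_flatten -map_comp.
have {1}-> : T = tabulate la (get T).
  by apply: (getT_ext (d := 0) eT (map_size_tabulate _ _)) => x ?; rewrite getT_tabulate.
by congr flatten; apply: eq_map => i /=; rewrite -map_comp.
Qed.

Lemma uniq_map_inj (X Y : eqType) (f : X -> Y) s :
  uniq (map f s) -> {in s &, injective f}.
Proof.
elim: s => [//|z s IH] /= /andP[zs us] x y; rewrite !inE.
case/orP=> [/eqP->|xs] /orP[/eqP->|ys] // e.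
- by rewrite e map_f in zs.
- by rewrite -e map_f in zs.
- exact: IH us x y xs ys e.
Qed.

Lemma tabloidP la n T : sumn la = n ->
  reflect [/\ map size T = la, forall x, in_diag la x -> 0 < get T x <= n
            & forall x y, in_diag la x -> in_diag la y -> get T x = get T y -> x = y]
          (is_tabloid la n T).
Proof.
move=> sn; apply: (iffP andP) => [[/eqP eT pT]|[eT rT iT]].
  have rc := flatten_row_cells eT; split=> // [x xl|x y xl yl].
    have : get T x \in flatten T by rewrite rc map_f // mem_row_cells.
    by rewrite (perm_mem pT) mem_iota; lia.
  have : uniq (flatten T) by rewrite (perm_uniq pT) iota_uniq.
  by rewrite rc => /uniq_map_inj; apply; rewrite mem_row_cells.
split; first by rewrite eT.
have rc := flatten_row_cells eT.
have uT : uniq (flatten T).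
  rewrite rc map_inj_in_uniq ?uniq_row_cells // => x y.
  by rewrite !mem_row_cells; apply: iT.
have sub : {subset flatten T <= iota 1 n}.
  move=> t; rewrite rc => /mapP[x]; rewrite mem_row_cells => /rT xl ->.
  by rewrite mem_iota; lia.
have [] := uniq_min_size uT sub; first by rewrite size_iota size_flatten /shape eT sn.
by move=> _ e; apply: uniq_perm; rewrite ?iota_uniq.
Qed.

(** * The diagram and the order of its cells *)

Lemma geq_trans : transitive geq.
Proof. by move=> x y z /=; lia. Qed.

Lemma nth_partition n la i j :
  is_partition n la -> i <= j -> nth 0 la j <= nth 0 la i.
Proof.
move=> /and3P[so _ _] ij; case: (ltnP j (size la)) => js; last by rewrite nth_default.
by apply: (sorted_leq_nth geq_trans leqnn 0 so); rewrite ?inE; lia.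
Qed.

Lemma in_diagE la i j : in_diag la (i, j) = (j < nth 0 la i).
Proof.
rewrite /in_diag /=; case: (ltnP i (size la)) => //= il.
by rewrite nth_default.
Qed.

Lemma lt_col_len n la i j : is_partition n la -> (i < col_len la j) = in_diag la (i, j).
Proof.
move=> /and3P[so _ _]; rewrite in_diagE /col_len.
elim: la i so => [|r la IH] i /=; first by rewrite nth_nil.
rewrite (path_sortedE geq_trans) => /andP[ar so].
have z : r <= j -> count (fun r => j < r) la = 0.
  move=> rj; apply/eqP; rewrite -leqn0 leqNgt -has_count; apply/hasPn => s sla.
  by have := allP ar s sla; rewrite /=; lia.
case: i => [|i] /=; [move: z|rewrite -IH //; move: z]; case: (ltnP j r); lia.
Qed.

Lemma in_diag_le n la i j i' j' :
  is_partition n la -> in_diag la (i, j) -> i' <= i -> j' <= j -> in_diag la (i', j').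
Proof.
move=> hla; rewrite !in_diagE => jl ii jj.
by have := nth_partition hla ii; lia.
Qed.

Lemma in_diag_head n la i j : is_partition n la -> in_diag la (i, j) -> j < head 0 la.
Proof.
by move=> hla; rewrite in_diagE -nth0; have := nth_partition hla (leq0n i); lia.
Qed.

(** The hook of the corner cell has [head 0 la + size la - 1] cells, all in the diagram. This makes
    the fuel of [slide] sufficient. *)
Lemma head_size n la : is_partition n la -> 0 < n -> head 0 la + size la <= n.+1.
Proof.
move=> /and3P[_ + /eqP <-] _; case: la => [//|r la] /= /andP[_ al].
elim: la al => [|s la IH] /=; first lia.
by move=> /andP[s0 /IH]; lia.
Qed.

(** This is the final segment of [cells la] starting at [(a, b)]. With [a = col_len la b] nothing of
    column [b] is left, which gives a meeting point with column [b.+1]. *)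
Definition suffix_cells (la : seq nat) (a b : nat) : seq cell :=
  [seq (i, b) | i <- iota a (col_len la b - a)] ++
  flatten [seq [seq (i, j) | i <- iota 0 (col_len la j)]
          | j <- iota b.+1 (head 0 la - b.+1)].

Definition after (a b : nat) (x : cell) : bool :=
  (b < x.2) || (x.2 == b) && (a <= x.1).

Lemma mem_suffix_cells n la a b x :
  is_partition n la -> (x \in suffix_cells la a b) = in_diag la x && after a b x.
Proof.
case: x => i j hla; rewrite mem_cat /after /=.
apply/idP/idP => [/orP[|]|/andP[xl]].
- move=> /mapP[k]; rewrite mem_iota => kl [-> ->].
  by rewrite -(lt_col_len _ _ hla); lia.
- move=> /flattenP[s /mapP[k]]; rewrite mem_iota => kl -> /mapP[l].
  rewrite mem_iota => ll [-> ->].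
  by rewrite -(lt_col_len _ _ hla); lia.
move=> /orP[bj|/andP[/eqP jb ai]]; apply/orP; [right|left].
  apply/flattenP; exists [seq (i, j) | i <- iota 0 (col_len la j)].
    apply/mapP; exists j => //; rewrite mem_iota.
    by have := in_diag_head hla xl; lia.
  by apply/mapP; exists i; rewrite // mem_iota add0n (lt_col_len _ _ hla).
rewrite {}jb in xl *; apply/mapP; exists i => //; rewrite mem_iota.
have := xl; rewrite -(lt_col_len _ _ hla).
by lia.
Qed.

Lemma suffix_cells_cons la a b :
  a < col_len la b -> suffix_cells la a b = (a, b) :: suffix_cells la a.+1 b.
Proof.
by move=> ac; rewrite /suffix_cells; have -> : col_len la b - a = (col_len la b - a.+1).+1 by lia.
Qed.

Lemma suffix_cells_next la b :
  b.+1 < head 0 la -> suffix_cells la (col_len la b) b = suffix_cells la 0 b.+1.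
Proof.
move=> bh; rewrite /suffix_cells subnn subn0.
by have -> : head 0 la - b.+1 = (head 0 la - b.+2).+1 by lia.
Qed.

Lemma suffix_cells_last la b : head 0 la = b.+1 -> suffix_cells la (col_len la b) b = [::].
Proof. by move=> bh; rewrite /suffix_cells bh !subnn. Qed.

(** Induction in the order of the algorithm: start past the end of the last column, climb each
    column, and pass from the top of a column to the end of the previous one. *)
Lemma suffix_cells_ind (la : seq nat) (P : nat -> nat -> Prop) :
  (forall b, head 0 la = b.+1 -> P (col_len la b) b) ->
  (forall b, b.+1 < head 0 la -> P 0 b.+1 -> P (col_len la b) b) ->
  (forall a b, b < head 0 la -> a < col_len la b -> P a.+1 b -> P a b) ->
  forall a b, b < head 0 la -> a <= col_len la b -> P a b.
Proof.
move=> Pl Pn Ps; have col b : b < head 0 la -> P (col_len la b) b ->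
    forall a, a <= col_len la b -> P a b.
  move=> bh Pc a ac; rewrite -(subKn ac).
  elim: (_ - a) {ac} => [|d IH]; first by rewrite subn0.
  case: (ltnP d (col_len la b)) => dc.
    by apply: Ps => //; [lia|have -> : (col_len la b - d.+1).+1 = col_len la b - d by lia].
  by have -> : col_len la b - d.+1 = col_len la b - d by lia.
move=> a b bh ac; apply: (col) => //.
have : head 0 la = (head 0 la - b.+1 + b).+1 by lia.
move: (head 0 la - b.+1) => d {ac}; elim: d b bh => [|d IH] b bh e; first by apply: Pl.
apply: Pn; first lia.
have bh' : b.+1 < head 0 la by lia.
by apply: (col _ bh') => //; apply: IH => //; lia.
Qed.

Lemma cells_split la a b : b < head 0 la -> a <= col_len la b ->
  exists2 s, cells la = s ++ suffix_cells la a b & forall x, x \in s -> ~~ after a b x.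
Proof.
move=> bh ac.
pose cl j := [seq (i, j) | i <- iota 0 (col_len la j)].
exists (flatten [seq cl j | j <- iota 0 b] ++ [seq (i, b) | i <- iota 0 a]).
  rewrite /cells /suffix_cells -catA.
  have {1}-> : head 0 la = b + (head 0 la - b.+1).+1 by lia.
  rewrite iotaD map_cat flatten_cat add0n; congr cat.
  rewrite [iota b _]/= [map _ (_ :: _)]/= [flatten _]/= catA; congr cat.
  by rewrite -map_cat -{1}(subnKC ac) iotaD.
move=> x; rewrite mem_cat /after => /orP[/flattenP[s /mapP[j]]|/mapP[i]].
  by rewrite mem_iota => jb -> /mapP[i _ ->] /=; lia.
by rewrite mem_iota => ia -> /=; lia.
Qed.

Lemma cells_suffix la : 0 < head 0 la -> cells la = suffix_cells la 0 0.
Proof.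
move=> h; have [s -> sP] := cells_split h (leq0n _).
by case: s sP => [//|x s] /(_ x (mem_head _ _)); rewrite /after; lia.
Qed.

Lemma drop_index_cells la a b : b < head 0 la -> a < col_len la b ->
  drop (index (a, b) (cells la)) (cells la) = suffix_cells la a b.
Proof.
move=> bh ac; have [s e sP] := cells_split bh (ltnW ac).
rewrite e index_cat; case: ifP => [/sP|_]; first by rewrite /after /= eqxx leqnn orbT.
by rewrite suffix_cells_cons // [index _ (_ :: _)]/= eqxx addn0 drop_size_cat.
Qed.

Lemma mem_cells n la x : is_partition n la -> (x \in cells la) = in_diag la x.
Proof.
move=> hla; case: (posnP (head 0 la)) => [h|h]; last first.
  by rewrite cells_suffix // (mem_suffix_cells _ _ _ hla) /after; case: x => i j; lia.
rewrite /cells h; case: x => i j; apply/esym/negP => /(in_diag_head hla); lia.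
Qed.

(* Cells are shifted by one: row [0] and column [0] are padding, on which
   backward paths stop; [N] stands for infinity outside the diagram, and the
   cells not selected by [pr] count as [0]. *)
Definition padded (la : seq nat) (N : nat) (pr : pred cell) (T : tab) : grid :=
  fun i j => match i, j with
  | 0, _ => if j <= head 0 la then 0 else N
  | _, 0 => 0
  | i'.+1, j'.+1 =>
    if ~~ pr (i', j') then 0 else if in_diag la (i', j') then get T (i', j') else N
  end.

(** * Single exchanges and the path of a slide *)

Lemma get_swap T p q x :
  get (swapT T p q) x = if x == q then get T p else if x == p then get T q else get T x.
Proof. by rewrite /get /swapT !getT_setT. Qed.

Lemma map_size_swap la T p q :
  map size T = la -> in_diag la p -> in_diag la q -> map size (swapT T p q) = la.
Proof. by move=> eT pl ql; apply: map_size_setT => //; apply: map_size_setT. Qed.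

Lemma swap_inj la T p q : in_diag la p -> in_diag la q ->
  (forall x y, in_diag la x -> in_diag la y -> get T x = get T y -> x = y) ->
  forall x y, in_diag la x -> in_diag la y ->
  get (swapT T p q) x = get (swapT T p q) y -> x = y.
Proof.
move=> pl ql iT x y xl yl.
pose s z := if z == q then p else if z == p then q else z.
have sl z : in_diag la z -> in_diag la (s z) by rewrite /s; do 2! case: ifP => // _.
have gs z : get (swapT T p q) z = get T (s z) by rewrite get_swap /s; do 2! case: ifP => // _.
rewrite !gs => /(iT _ _ (sl _ xl) (sl _ yl)).
by rewrite /s; case: (x =P q); case: (y =P q); case: (x =P p); case: (y =P p); congruence.
Qed.

(** Induction over exchanges that forgets that the smaller neighbour was chosen; enough for
    properties depending only on exchanges with smaller neighbours. *)
Lemma slide_aux_ind (la : seq nat) (R : tab -> cell -> tab * cell -> Prop) :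
  (forall T p, in_diag la p -> R T p (T, p)) ->
  (forall T p q res, in_diag la p -> in_diag la q ->
     q = (p.1, p.2.+1) \/ q = (p.1.+1, p.2) -> get T q < get T p ->
     R (swapT T p q) q res -> R T p res) ->
  forall fuel T p, in_diag la p -> R T p (slide_aux fuel la T p).
Proof.
move=> R0 RS; elim=> [|f IH] T p pl /=; first exact: R0.
case: ifP => [/andP[rl dl]|_].
  by case: ifP => _; case: ifP => lt; try exact: R0; apply: (RS _ _ _ _ pl _ _ lt) => //;
    [left|apply: IH|right|apply: IH].
case: ifP => [rl|_].
  by case: ifP => lt; try exact: R0; apply: (RS _ _ _ _ pl _ _ lt) => //; [left|apply: IH].
case: ifP => [dl|_]; last exact: R0.
by case: ifP => lt; try exact: R0; apply: (RS _ _ _ _ pl _ _ lt) => //; [right|apply: IH].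
Qed.

Lemma slide_end la T p : in_diag la p ->
  let: (T', e) := slide la T p in
  [/\ in_diag la e, p.1 <= e.1, p.2 <= e.2 & get T' e = get T p].
Proof.
move=> pl; rewrite /slide; apply: (slide_aux_ind (R := fun T p r =>
  let: (T', e) := r in [/\ in_diag la e, p.1 <= e.1, p.2 <= e.2 & get T' e = get T p])) pl => [//|].
move=> {}T {}p q [T' e] pl ql pq _.
by rewrite get_swap eqxx; case: pq => -> /= [? ? ? ->]; split=> //; lia.
Qed.

Lemma slide_other la T p x : in_diag la p -> ~~ ((p.1 <= x.1) && (p.2 <= x.2)) ->
  get (slide la T p).1 x = get T x.
Proof.
move=> pl; rewrite /slide; apply: (slide_aux_ind (R := fun T p r =>
  ~~ ((p.1 <= x.1) && (p.2 <= x.2)) -> get r.1 x = get T x)) pl => [//|].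
move=> {}T {}p q [T' e] pl ql pq _ IH off.
have nq : ~~ ((q.1 <= x.1) && (q.2 <= x.2)) by case: pq => ->; rewrite /=; lia.
rewrite (IH nq) get_swap; case: eqP nq => [->|_ nq]; first by rewrite !leqnn.
by case: eqP off => [->|//]; rewrite !leqnn.
Qed.

Lemma slide_tabloid la n T p : sumn la = n -> in_diag la p ->
  is_tabloid la n T -> is_tabloid la n (slide la T p).1.
Proof.
move=> sn pl; rewrite /slide; apply: (slide_aux_ind (R := fun T p r =>
  is_tabloid la n T -> is_tabloid la n r.1)) pl => [//|].
move=> {}T {}p q [T' e] pl ql _ _ IH tT; apply: IH.
case/(tabloidP T sn): tT => eT rT iT; apply/(tabloidP _ sn); split.
- exact: map_size_swap.
- move=> x xl; rewrite get_swap.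
  by case: eqP => _; [apply: rT|case: eqP => _; apply: rT].
- exact: swap_inj.
Qed.

(** Giving missing neighbours the value [N] turns the cases of the algorithm into plain
    comparisons. *)
Lemma slide_auxS la N f T p : in_diag la p ->
  (forall x, in_diag la x -> get T x < N) ->
  let g := padded la N predT T in
  let r := (p.1, p.2.+1) in let d := (p.1.+1, p.2) in
  let gp := g p.1.+1 p.2.+1 in
  let gr := g p.1.+1 p.2.+2 in let gd := g p.1.+2 p.2.+1 in
  slide_aux f.+1 la T p =
  if (gr < gd) && (gr < gp) then slide_aux f la (swapT T p r) r
  else if (gd <= gr) && (gd < gp) then slide_aux f la (swapT T p d) d
  else (T, p).
Proof.
case: p => i j pl TN /=; rewrite pl.
have pN := TN _ pl; have rN := TN (i, j.+1); have dN := TN (i.+1, j).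
case: (boolP (in_diag la (i, j.+1))) => rl; case: (boolP (in_diag la (i.+1, j))) => dl /=.
- by case: ltnP.
- rewrite (rN rl) /=; case: ifP => // _.
  by rewrite leqNgt (rN rl).
- by rewrite (ltnNge N) (ltnW (dN dl)).
- by rewrite ltnn leqnn /= (ltnNge N) (ltnW pN).
Qed.

Lemma padded_swap la N T p q : in_diag la p -> in_diag la q -> forall i j,
  padded la N predT (swapT T p q) i j =
  if (i, j) == (q.1.+1, q.2.+1) then padded la N predT T p.1.+1 p.2.+1
  else if (i, j) == (p.1.+1, p.2.+1) then padded la N predT T q.1.+1 q.2.+1
  else padded la N predT T i j.
Proof.
move=> pl ql [|i] [|j]; rewrite !xpair_eqE ?eqSS ?andbF //= -!surjective_pairing pl ql.
rewrite get_swap; have e x : ((i, j) == x) = (i == x.1) && (j == x.2) by case: x.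
rewrite !{}e; case: (boolP ((i == q.1) && (j == q.2))) => [/andP[/eqP-> /eqP->]|_].
  by rewrite -surjective_pairing ql.
case: (boolP ((i == p.1) && (j == p.2))) => [/andP[/eqP-> /eqP->]|//].
by rewrite -surjective_pairing pl.
Qed.

(** Each exchange lowers the left side of the fuel bound by one. With no fuel the bound is
    impossible, since both summands are positive for a cell of the diagram. *)
Lemma slide_aux_slid n la N fuel T p : is_partition n la -> in_diag la p ->
  (forall x, in_diag la x -> get T x < N) ->
  (forall x y, in_diag la x -> in_diag la y -> get T x = get T y -> x = y) ->
  (head 0 la - p.2) + (size la - p.1) <= fuel.+1 ->
  let: (T', e) := slide_aux fuel la T p in
  exists v, [/\ v p.1.+1 = p.2.+1, v e.1.+2 = e.2.+1 &
    slid (padded la N predT T) (padded la N predT T') (get T p) p.1.+1 e.1.+1 v].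
Proof.
move=> hla; elim: fuel T p => [|f IH] T p pl TN Ti fuel.
  move: pl fuel; case: p => i j pl /=; have := in_diag_head hla pl.
  by move: pl; rewrite /in_diag /=; lia.
rewrite (slide_auxS f pl TN); set g := padded _ _ _ T.
set r := (p.1, p.2.+1); set d := (p.1.+1, p.2).
have gp : g p.1.+1 p.2.+1 = get T p by rewrite /g /= -surjective_pairing pl.
have small q : g q.1.+1 q.2.+1 < g p.1.+1 p.2.+1 ->
    [/\ in_diag la q, g q.1.+1 q.2.+1 = get T q,
        forall x, in_diag la x -> get (swapT T p q) x < N &
        forall x y, in_diag la x -> in_diag la y ->
          get (swapT T p q) x = get (swapT T p q) y -> x = y].
  rewrite gp; move: (TN _ pl); rewrite /g /= -surjective_pairing.
  case: ifP => [ql|_]; last lia.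
  move=> _ _; split=> //; last exact: swap_inj.
  by move=> x xl; rewrite get_swap; case: eqP => _; [|case: eqP => _]; apply: TN.
case: ifP => [/andP[rd rp]|nr].
  have [rl gr TN' Ti'] := small r rp.
  have := IH (swapT T p r) r rl TN' Ti' _; case: slide_aux => T' e.
  case=> [|v [v1 v2 sl]]; first by have := in_diag_head hla rl; rewrite /=; lia.
  have le := slid_rows sl.
  exists (fun i => if i == p.1.+1 then p.2.+1 else v i); split; rewrite ?eqxx //.
    by case: eqP => [e1|//]; move: le; rewrite /= in e1 *; lia.
  rewrite get_swap eqxx in sl; rewrite gp in rp.
  apply: slid_cons_right rd rp sl v1.
  - by move=> i j ij ij'; rewrite (padded_swap _ _ pl rl) (negbTE ij) (negbTE ij').
  - by rewrite (padded_swap _ _ pl rl) xpair_eqE /= eqxx; case: eqP => [|_]; [lia|rewrite eqxx].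
case: ifP => [/andP[dr dp]|nd].
  have [dl gd TN' Ti'] := small d dp.
  have := IH (swapT T p d) d dl TN' Ti' _; case: slide_aux => T' e.
  case=> [|v [v1 v2 sl]]; first by have := dl; rewrite /in_diag /=; lia.
  have le := slid_rows sl.
  exists (fun i => if i == p.1.+1 then p.2.+1 else v i); split; rewrite ?eqxx //.
    by case: eqP => [e1|//]; move: le; rewrite /= in e1 *; lia.
  rewrite get_swap eqxx in sl; rewrite gp in dp.
  (* The algorithm gives only a weak inequality here; it is strict because the entries are
     distinct. *)
  have dr' : g p.1.+2 p.2.+1 < g p.1.+1 p.2.+2.
    rewrite ltn_neqAle dr andbT; apply/eqP => eg.
    have rp : g r.1.+1 r.2.+1 < g p.1.+1 p.2.+1 by rewrite -eg gp.
    have [rl gr _ _] := small r rp.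
    have := Ti d r dl rl; rewrite -gd -gr => /(_ eg) [] ; lia.
  apply: slid_cons_down dr' dp sl v1.
  - by move=> i j ij ij'; rewrite (padded_swap _ _ pl dl) (negbTE ij) (negbTE ij').
  - rewrite (padded_swap _ _ pl dl) xpair_eqE /= eqxx andbT.
    by case: eqP => [|_]; [lia|rewrite eqxx].
have lt q : q = r \/ q = d -> g p.1.+1 p.2.+1 < g q.1.+1 q.2.+1.
  move=> eq; rewrite ltn_neqAle; apply/andP; split; last first.
    by case: eq => ->; move: nr nd; rewrite /=; lia.
  apply/eqP => eg; have := TN _ pl; rewrite -gp eg {1}/g /= -surjective_pairing.
  case: ifP => [ql _|]; last by rewrite ltnn.
  have : p = q by apply: Ti => //; rewrite -gp eg /g /= -surjective_pairing ql.
  by move=> /(congr1 (fun x => x.1 + x.2)); case: eq => -> /=; lia.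
exists (fun=> p.2.+1); split=> //; rewrite -gp.
by apply: slid_nil; [apply: (lt r); left|apply: (lt d); right].
Qed.

(** * One slide, with its hook update *)

Definition sorted_after (la : seq nat) (a b : nat) (T : tab) : Prop :=
  forall i j, after a b (i, j) ->
  (in_diag la (i, j.+1) -> get T (i, j) < get T (i, j.+1)) /\
  (in_diag la (i.+1, j) -> get T (i, j) < get T (i.+1, j)).

Lemma after_right a b i j : after a b (i, j) -> after a b (i, j.+1).
Proof. by rewrite /after /=; lia. Qed.

Lemma after_down a b i j : after a b (i, j) -> after a b (i.+1, j).
Proof. by rewrite /after /=; lia. Qed.

Lemma padded_sorted n la N a b T :
  is_partition n la -> b < head 0 la ->
  (forall x, in_diag la x -> 0 < get T x < N) -> 0 < N ->
  sorted_after la a b T ->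
  sorted_grid N (head 0 la) a.+1 b.+1 (padded la N (after a b) T).
Proof.
move=> hla bh TN N0 so; set f := padded _ _ _ _.
have le i j : f i j <= N.
  rewrite /f; case: i j => [|i] [|j] //=; first by case: ifP.
  by case: ifP => // _; case: ifP => // /TN; lia.
have out i j k l : ~~ in_diag la (i, j) -> i <= k -> j <= l -> ~~ in_diag la (k, l).
  by move=> ol ik jl; apply: contra ol => kl; apply: in_diag_le hla kl ik jl.
have row i j : f i j <= f i j.+1 /\ (0 < f i j < N -> f i j < f i j.+1).
  case: i j => [|i] [|j] //=; rewrite /f /=.
    by do 2! case: ifP; lia.
  case: (boolP (after a b (i, j))) => //= aij; rewrite (after_right aij) /=.
  case: (boolP (in_diag la (i, j))) => ij; last first.
    by rewrite (negbTE (out _ _ i j.+1 ij _ _)) //; lia.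
  case: ifP => ij'; last by have := TN _ ij; lia.
  by have [/(_ ij')] := so i j aij; lia.
have col i j : f i j <= f i.+1 j /\ (0 < f i j < N -> f i j < f i.+1 j).
  case: i j => [|i] [|j] //=; rewrite /f /=.
    case: ifP => jh; first by split; lia.
    have -> : after a b (0, j) by rewrite /after /=; lia.
    by case: ifP => [/(in_diag_head hla)|]; lia.
  case: (boolP (after a b (i, j))) => //= aij; rewrite (after_down aij) /=.
  case: (boolP (in_diag la (i, j))) => ij; last first.
    by rewrite (negbTE (out _ _ i.+1 j ij _ _)) //; lia.
  case: ifP => ij'; last by have := TN _ ij; lia.
  by have [_ /(_ ij')] := so i j aij; lia.
split=> //; try by move=> i j; case: (row i j); case: (col i j).
- case=> // i [|j] _ //=; rewrite /f /= /after /=.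
  case: (boolP ((b < j) || (j == b) && (a <= i))) => /= h; last by lia.
  by case: ifP => [/TN|]; lia.
- by move=> j jh; rewrite /f /= jh.
- case=> [|i] [|j] jh //; rewrite /f /=; first by rewrite leqNgt jh.
  have -> : after a b (i, j) by rewrite /after /=; lia.
  by case: ifP => // /(in_diag_head hla); lia.
Qed.

Lemma sorted_padded la N M a b A B T :
  (forall x, in_diag la x -> 0 < get T x < N) ->
  (forall i j i' j', in_diag la (i, j) -> i' <= i -> j' <= j -> in_diag la (i', j')) ->
  sorted_grid N M A B (padded la N (after a b) T) -> sorted_after la a b T.
Proof.
move=> TN dle sg i j aij; split=> ij.
  have ij' : in_diag la (i, j) by apply: dle ij _ _.
  have := @sg_row_lt _ _ _ _ _ sg i.+1 j.+1.
  by rewrite /= aij (after_right aij) /= ij ij'; apply; apply: TN.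
have ij' : in_diag la (i, j) by apply: dle ij _ _.
have := @sg_col_lt _ _ _ _ _ sg i.+1 j.+1.
by rewrite /= aij (after_down aij) /= ij ij'; apply; apply: TN.
Qed.

Lemma slide_slid n la T a b :
  is_partition n la -> b < head 0 la -> in_diag la (a, b) ->
  is_tabloid la n T -> sorted_after la a.+1 b T ->
  let: (T', e) := slide la T (a, b) in
  let f := padded la n.+1 (after a.+1 b) T in
  let g := padded la n.+1 (after a b) T' in
  exists v, [/\ v a.+1 = b.+1 /\ v e.1.+2 = e.2.+1,
    slid f g (get T (a, b)) a.+1 e.1.+1 v, is_back g a.+1 e.1.+1 v,
    sorted_grid n.+1 (head 0 la) a.+2 b.+1 f & sorted_grid n.+1 (head 0 la) a.+1 b.+1 g].
Proof.
move=> hla bh ab tT so; have sn : sumn la = n by case/and3P: hla => _ _ /eqP.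
case/(tabloidP T sn): (tT) => eT rT iT.
have n0 : 0 < n by have := rT _ ab; lia.
have TN x : in_diag la x -> get T x < n.+1 by move=> /rT; lia.
have := slide_aux_slid (fuel := sumn la) hla ab TN iT; rewrite /= sn.
have := head_size hla n0 => hs /(_ ltac:(lia)).
have := slide_other (la := la) T (p := (a, b)); rewrite /slide sn.
case: slide_aux => T' e oth [v [v1 v2 sl]].
have sl' : slid (padded la n.+1 (after a.+1 b) T) (padded la n.+1 (after a b) T')
    (get T (a, b)) a.+1 e.1.+1 v.
  apply: slid_mask sl _ _ _; rewrite v1.
  - case=> [|i] [|j] //= ai bj; rewrite xpair_eqE => ne.
    by have -> : after a.+1 b (i, j) by rewrite /after /=; lia.
  - case=> [|i] [|j] //= ai bj.
    by have -> : after a b (i, j) by rewrite /after /=; lia.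
  - case=> [|i] [|j] //= ij.
    have -> : after a.+1 b (i, j) = after a b (i, j) by rewrite /after /=; lia.
    by case: ifP => //; case: ifP => // _ _; rewrite -[get T' _]/(get (T', e).1 _) oth.
have rT' x : in_diag la x -> 0 < get T x < n.+1 by move=> /rT; lia.
have sf := padded_sorted hla bh rT' isT so.
have r0 := rT _ ab.
exists v; split=> //.
- by apply: slid_back sf sl' v1; lia.
- by apply: slid_sorted sf sl' v1; lia.
Qed.

Lemma hget_update H a b a' b' i j : a <= a' ->
  hget (hook_update H (a, b) (a', b')) (i, j) =
  if j != b then hget H (i, j)
  else if i == a' then (b'%:Z - b%:Z)%R
  else if a <= i < a' then (hget H (i.+1, b) - 1)%R else hget H (i, b).
Proof.
move=> aa; rewrite /hget /hook_update getT_setT /= xpair_eqE.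
(* All right-hand sides read the old [H], so the writes do not influence one another. *)
have fold s K : getT 0%R (foldl (fun acc c => Defs.setT 0%R acc (c, b)
      (getT 0%R H (c.+1, b) - 1)%R) K s) (i, j) =
    if (j == b) && (i \in s) then (getT 0%R H (i.+1, b) - 1)%R else getT 0%R K (i, j).
  elim: s K => [|c s IH] K /=; first by rewrite andbF.
  rewrite IH getT_setT xpair_eqE inE.
  case: (eqVneq j b) => _ /=; rewrite ?andbF // andbT.
  by case: (i \in s); rewrite ?orbT ?orbF //; case: eqP => // ->.
rewrite fold mem_iota subnKC // andbC.
by case: (eqVneq j b) => [->|] //=; case: eqP.
Qed.

Lemma map_size_update la H a b a' b' :
  map size H = la -> (forall i, a <= i <= a' -> in_diag la (i, b)) -> a <= a' ->
  map size (hook_update H (a, b) (a', b')) = la.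
Proof.
move=> eH ab aa; rewrite /hook_update; apply: map_size_setT; last by apply: ab => /=; lia.
have gen s K : map size K = la -> {in s, forall c, in_diag la (c, b)} ->
    map size (foldl (fun acc c => Defs.setT 0%R acc (c, b)
      (hget H (c.+1, b) - 1)%R) K s) = la.
  elim: s K => [//|c s IH] K eK ac /=.
  apply: IH => [|d ds]; last by apply: ac; rewrite inE ds orbT.
  by apply: map_size_setT => //; apply: ac; rewrite mem_head.
by apply: gen => // c; rewrite mem_iota /= => ac; apply: ab; lia.
Qed.

(** Rows are shifted by one to match [padded]. *)
Definition hook_col (H : htab) (b : nat) : nat -> int := fun i => hget H (i.-1, b).

Lemma hook_update_step H a b a' b' c : a <= a' ->
  hook_step b.+1 a.+1 a'.+1 c b'.+1 (hook_col H b)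
    (hook_col (hook_update H (a, b) (a', b')) b).
Proof.
move=> aa; split=> [i ia||i ia]; rewrite /hook_col hget_update // eqxx /=.
- case: i ia => [|i] // ia; rewrite /=.
  have -> : (i == a') = false by lia.
  by have -> : a <= i < a' by lia.
- by rewrite eqxx; lia.
- case: i ia => [|i] // ia; rewrite /=.
  have -> : (i == a') = false by lia.
  by have -> : a <= i < a' = false by lia.
Qed.

(** The invariant once the cells from [(a, b)] on are processed; it turns out to describe exactly
    the pairs that occur. In [st_path], the padded position [(a, b.+1)] is the next cell
    [(a.-1, b)], or a padding cell if [a = 0]. *)
Record state (n : nat) (la : seq nat) (a b : nat) (TH : tab * htab) : Prop := State {
  st_tabloid : is_tabloid la n TH.1;
  st_sorted : sorted_after la a b TH.1;
  st_shape : map size TH.2 = la;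
  st_range : forall x, in_diag la x -> after a b x ->
    (- (leg la x)%:Z <= hget TH.2 x <= (arm la x)%:Z)%R;
  st_zero : forall x, in_diag la x -> ~~ after a b x -> hget TH.2 x = 0%R;
  st_path : forall u, is_fwd (padded la n.+1 (after a b) TH.1) a u -> u a = b.+1 ->
    below_path b.+1 a.+1 (col_len la b) (hook_col TH.2 b) u }.

Lemma arm_le la i j : in_diag la (i, j) -> (arm la (i, j)).+1 + j = nth 0 la i.
Proof. by rewrite in_diagE /arm /=; lia. Qed.

Lemma state_step n la a b TH :
  is_partition n la -> b < head 0 la -> a < col_len la b ->
  state n la a.+1 b TH -> state n la a b (nps_step la TH (a, b)).
Proof.
case: TH => T H hla bh ac [/= tT so sH rH zH pH].
have sn : sumn la = n by case/and3P: hla => _ _ /eqP.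
have ab : in_diag la (a, b) by rewrite -(lt_col_len _ _ hla).
have := slide_slid hla bh ab tT so.
have := slide_end T ab; have := slide_tabloid sn ab tT; rewrite /nps_step /=.
case: slide => T' [a' b'] /= tT' [el aa bb _] [v [[v1 v2] sl kv sf sg]].
have colb i : i <= a' -> in_diag la (i, b) by move=> ia; apply: in_diag_le hla el ia bb.
have ac' : a' < col_len la b by rewrite (lt_col_len _ _ hla) colb.
split=> //=.
- case/(tabloidP _ sn): tT' => _ r' _; apply: sorted_padded sg.
    by move=> x /r'; lia.
  by move=> i j i' j' ij; apply: in_diag_le hla ij.
- by apply: map_size_update => // i ia; apply: colb; lia.
- move=> [i j] ij; rewrite /after /= => aij; rewrite hget_update //.
  case: (eqVneq j b) ij aij => [->|jb] ij aij /=; last first.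
    by apply: rH => //; rewrite /after /=; lia.
  case: (eqVneq i a') => [->|ia].
    by have := arm_le el; have := arm_le (colb a' (leqnn _)); lia.
  case: ifP => iaa; last by apply: rH => //; rewrite /after /=; lia.
  (* Going up one row raises the leg by one and does not lower the arm, so the hook of row [i.+1]
     minus one is in range for row [i]. *)
  have il := colb i.+1 ltac:(lia).
  have := rH _ il; rewrite /after /= => /(_ ltac:(lia)).
  have := arm_le il; have := arm_le ij; have := nth_partition hla (leqnSn i).
  have := il; rewrite -(lt_col_len _ _ hla) /leg /=.
  lia.
- move=> [i j] ij; rewrite /after /= => aij; rewrite hget_update //.
  have za : hget H (i, j) = 0%R by apply: zH; rewrite // /after /=; lia.
  case: (eqVneq j b) aij za => [->|//] aij za /=.
  have -> : (i == a') = false by lia.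
  by have -> : a <= i < a' = false by lia.
- move=> w gw wb.
  have [u ub fu] := fwd_exists a.+1 b.+1 (sg_top sf) (sg_far sf).
  apply: (below_path_step _ _ sl kv v1 _ fu ub (pH u fu ub) gw wb) => //.
  rewrite v2; exact: hook_update_step.
Qed.

(** The path tells where every displaced entry came from, except for the starting cell, on which
    [slid] says nothing. *)
Lemma slid_inj (f1 f2 g : grid) x1 x2 A a v1 v2 :
  slid f1 g x1 A a v1 -> slid f2 g x2 A a v2 ->
  (forall i, A <= i <= a.+1 -> v1 i = v2 i) ->
  forall i j, (i, j) != (A, v1 A) -> f1 i j = f2 i j.
Proof.
move=> s1 s2 ev i j ne; have Aa := slid_rows s1.
have op : on_path A a v1 i j = on_path A a v2 i j.
  by rewrite /on_path; case: (boolP (A <= i <= a)) => //= Ai; rewrite !ev //; lia.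
case: (boolP (on_path A a v1 i j)) => on; last first.
  by rewrite -(slid_off s1 on) -(slid_off s2) // -op.
case/andP: (on) => Ai /andP[vj jv].
have ei := ev i ltac:(lia); have ei' := ev i.+1 ltac:(lia).
case: (ltnP (v1 i) j) => vj'.
  have [_ _] := @slid_right _ _ _ _ _ _ s1 i j.-1 Ai ltac:(lia).
  have [_ _] := @slid_right _ _ _ _ _ _ s2 i j.-1 Ai ltac:(lia).
  by rewrite prednK; [congruence|lia].
have ej : j = v1 i by lia.
have iA : A < i.
  by move: ne; rewrite xpair_eqE ej; case: (eqVneq i A) => [->|]; rewrite ?eqxx //; lia.
have [_ _] := slid_down s1 (i := i.-1) ltac:(lia).
have [_ _] := slid_down s2 (i := i.-1) ltac:(lia).
by rewrite prednK -?ei -?ej; [congruence|lia].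
Qed.

(** The hooks determine the final cell by [endpoint_unique], this cell determines the path by
    [back_unique], and the path determines the old filling. The shift of the hooks is then
    undone. *)
Lemma state_step_inj n la a b TH1 TH2 :
  is_partition n la -> b < head 0 la -> a < col_len la b ->
  state n la a.+1 b TH1 -> state n la a.+1 b TH2 ->
  nps_step la TH1 (a, b) = nps_step la TH2 (a, b) -> TH1 = TH2.
Proof.
case: TH1 TH2 => [T1 H1] [T2 H2] hla bh ac [/= t1 so1 sH1 r1 z1 p1] [/= t2 so2 sH2 r2 z2 p2].
have sn : sumn la = n by case/and3P: hla => _ _ /eqP.
have ab : in_diag la (a, b) by rewrite -(lt_col_len _ _ hla).
have := slide_slid hla bh ab t1 so1; have := slide_slid hla bh ab t2 so2.
have := slide_end T1 ab; have := slide_end T2 ab; rewrite /nps_step /=.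
have := slide_other (la := la) T1 (p := (a, b)).
have := slide_other (la := la) T2 (p := (a, b)).
case: slide => T2' [a2 b2] /= o2; case: slide => T1' [a1 b1] /= o1.
case=> e2 aa2 bb2 g2 [e1 aa1 bb1 g1] [v2 [[v2A v2e] s2 k2 sf2 sg2]].
case=> v1 [[v1A v1e] s1 k1 sf1 sg1] [eT eH].
rewrite {}eT in o1 g1 s1 k1 sg1.
have col i j : in_diag la (i, j) -> b <= j -> i < col_len la b.
  by move=> ij bj; rewrite (lt_col_len _ _ hla); apply: in_diag_le hla ij _ bj.
have [u1 u1A fu1] := fwd_exists a.+1 b.+1 (sg_top sf1) (sg_far sf1).
have [u2 u2A fu2] := fwd_exists a.+1 b.+1 (sg_top sf2) (sg_far sf2).
have h1 := hook_update_step H1 b b1 (col_len la b) aa1.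
have h2 := hook_update_step H2 b b2 (col_len la b) aa2.
rewrite eH -v1e in h1; rewrite -v2e in h2.
have [ea eb] := endpoint_unique s1 s2 k1 k2 v1A v2A (col _ _ e1 bb1) (col _ _ e2 bb2)
  h1 h2 fu1 u1A (p1 _ fu1 u1A) fu2 u2A (p2 _ fu2 u2A).
case: ea => ea; rewrite {}ea in v1e s1 k1 eb h1 aa1 e1 g1 o1 eH *.
have {}eb : b1 = b2 by congruence.
rewrite {}eb in v1e e1 bb1 g1 eH.
have ev := back_unique k1 k2 (etrans v1A (esym v2A)) (etrans v1e (esym v2e)).
have ef := slid_inj s1 s2 ev.
have -> : T1 = T2.
  case/(tabloidP _ sn): t1 => eT1 _ _; case/(tabloidP _ sn): t2 => eT2 _ _.
  apply: (getT_ext (d := 0) eT1 eT2) => -[i j] ij; rewrite -!/(get _ _).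
  case: (boolP ((a <= i) && (b <= j))) => off; last by rewrite -o1 // -o2.
  (* The old entry of the starting cell is the one now in the common final cell. *)
  case: (eqVneq (i, j) (a, b)) => [[-> ->]|ne]; first by rewrite -g1 -g2.
  have := ef i.+1 j.+1; rewrite v1A /= ij.
  have -> /= : after a.+1 b (i, j) by rewrite xpair_eqE in ne; rewrite /after /=; lia.
  by apply; rewrite xpair_eqE !eqSS -xpair_eqE.
congr pair; apply: (getT_ext (d := 0%R) sH1 sH2) => -[i j] ij; rewrite -!/(hget _ _).
have hu k l : hget (hook_update H1 (a, b) (a2, b2)) (k, l) =
              hget (hook_update H2 (a, b) (a2, b2)) (k, l) by rewrite eH.
case: (eqVneq j b) ij => [->|jb] ij; last by have := hu i j; rewrite !hget_update // jb.
(* The update overwrites the hook of row [a] for good, but it was 0 like all hooks of unprocessed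
   cells. *)
case: (leqP i a) => ia; first by rewrite z1 ?z2 // /after /=; lia.
case: (leqP i a2) => ia2.
  have := hu i.-1 b; rewrite !hget_update // eqxx /=.
  have -> : (i.-1 == a2) = false by lia.
  have -> : a <= i.-1 < a2 by lia.
  by rewrite prednK; [move/GRing.addIr|lia].
have := hu i b; rewrite !hget_update // eqxx /=.
have -> : (i == a2) = false by lia.
by have -> : a <= i < a2 = false by lia.
Qed.

(** * Undoing one step of the algorithm *)

(** The undone filling has at [x] the entry that the given filling has at [unslide_cell a b e v x]:
    the predecessor on the path, or [e] for the starting cell. In contrast to [unslide], no entry is
    lost. *)
Definition unslide_cell (a b : nat) (e : cell) (v : nat -> nat) (x : cell) : cell :=
  if x == (a, b) then e
  else if on_path a.+1 e.1.+1 v x.1.+1 x.2.+1 then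
    if v x.1.+1 < x.2.+1 then (x.1, x.2.-1) else (x.1.-1, x.2)
  else x.

Lemma unslide_cell_path a b e v (g : grid) x : is_back g a.+1 e.1.+1 v ->
  v a.+1 = b.+1 -> v e.1.+2 = e.2.+1 -> on_path a.+1 e.1.+1 v x.1.+1 x.2.+1 ->
  let y := unslide_cell a b e v x in
  on_path a.+1 e.1.+1 v y.1.+1 y.2.+1.
Proof.
case: x => i j kv vA ve on; have := on => /andP[/= Ai /andP[vj jv]].
have m k := back_mono kv (i := k); have vle := back_le kv (i := a.+1) (leqnn _).
rewrite /unslide_cell on /=; case: (eqVneq (i, j) (a, b)) => [_|ne].
  by rewrite /on_path -ve; have := m e.1.+1; lia.
have vi := vle i.+1; rewrite vA in vi.
case: ifP => vj'; rewrite /on_path /=; first by rewrite prednK; lia.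
have ia : a < i.
  by move: ne; rewrite xpair_eqE; case: (eqVneq i a) vj vj' => [->|]; rewrite ?vA; lia.
by rewrite prednK; [have := m i; lia|lia].
Qed.

(** The map is a cyclic shift along the path and the identity elsewhere. Injectivity makes the
    undone filling a tabloid. *)
Lemma unslide_cell_inj a b e v (g : grid) : is_back g a.+1 e.1.+1 v ->
  a <= e.1 -> v a.+1 = b.+1 -> v e.1.+2 = e.2.+1 -> injective (unslide_cell a b e v).
Proof.
move=> kv ae vA ve [i j] [i' j'].
have m k := back_mono kv (i := k); have vle := back_le kv (i := a.+1) (leqnn _).
have onab : on_path a.+1 e.1.+1 v a.+1 b.+1 by rewrite /on_path vA; have := m a.+1; lia.
have key k l k' l' : unslide_cell a b e v (k, l) = unslide_cell a b e v (k', l') ->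
    on_path a.+1 e.1.+1 v k.+1 l.+1 -> on_path a.+1 e.1.+1 v k'.+1 l'.+1.
  move=> ekl on; have := unslide_cell_path (x := (k, l)) kv vA ve on; rewrite /= ekl.
  rewrite /unslide_cell; case: (eqVneq (k', l') (a, b)) => [[-> ->]//|_].
  by rewrite /=; case: (boolP (on_path _ _ _ k'.+1 l'.+1)) => //= /negbTE->.
have pos k l : on_path a.+1 e.1.+1 v k.+1 l.+1 -> (k, l) != (a, b) ->
    [/\ a <= k <= e.1, b < v k.+1 & v k.+1 <= l.+1 <= v k.+2] /\ (v k.+1 < l.+1 \/ a < k).
  move=> /andP[/= Ak kl]; rewrite xpair_eqE => ne.
  have vk : v a.+1 <= v k.+1 by apply: vle; lia.
  split; first by split; lia.
  case: (ltnP (v k.+1) l.+1) => h; first by left.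
  right; case: (eqVneq k a) ne => [ek|]; last lia.
  by rewrite ek in h kl *; move=> /=; lia.
move=> e12; have o12 := key _ _ _ _ e12; have o21 := key _ _ _ _ (esym e12).
move: e12; rewrite /unslide_cell.
case: (boolP (on_path _ _ _ i.+1 j.+1)) o12 => on1 o12; last first.
  case: (eqVneq (i, j) (a, b)) on1 => [[-> ->]|_ on1]; first by rewrite onab.
  case: (boolP (on_path _ _ _ i'.+1 j'.+1)) o21 => on2 o21; first by rewrite (o21 isT) in on1.
  by case: (eqVneq (i', j') (a, b)) on2 => [[-> ->]|//]; rewrite onab.
have on2 := o12 isT; rewrite on2.
case: (eqVneq (i, j) (a, b)) => [[-> ->]|ne1]; case: (eqVneq (i', j') (a, b)) => [[-> ->]|ne2] //=.
- have [[h1 h2 h3] h4] := pos _ _ on2 ne2.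
  case: ifP => h5 e1; have E1 := congr1 fst e1; have E2 := congr1 snd e1;
    by rewrite /= in E1 E2; rewrite {}E1 {}E2 in ve h1; lia.
- have [[h1 h2 h3] h4] := pos _ _ on1 ne1.
  case: ifP => h5 /esym e1; have E1 := congr1 fst e1; have E2 := congr1 snd e1;
    by rewrite /= in E1 E2; rewrite {}E1 {}E2 in ve h1; lia.
have [[h1 h2 h3] h4] := pos _ _ on1 ne1; have [[k1 k2 k3] k4] := pos _ _ on2 ne2.
have m1 := m i.+1; have m2 := m i'.+1.
case: ifP => l1; case: ifP => l2 [e1 e2].
- by rewrite -{}e1 in k2 k3 l2 *; congr pair; lia.
- have ei : i' = i.+1 by lia.
  by rewrite ei in k2 k3 l2; lia.
- have ei : i = i'.+1 by lia.
  by rewrite ei in h2 h3 l1; lia.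
- by rewrite e2; congr pair; lia.
Qed.

Lemma eq_sorted_grid (f g : grid) N M A B :
  f =2 g -> sorted_grid N M A B f -> sorted_grid N M A B g.
Proof.
by move=> e [h1 h2 h3 h4 h5 h6 h7 h8]; split=> *; rewrite -?e;
  rewrite -?e in h1 h2 h3 h4 h5 h6 h7 h8 *; auto; [apply: h4|apply: h5]; rewrite e.
Qed.

Lemma eq_slid (f f' g : grid) x0 A a v :
  f =2 f' -> slid f g x0 A a v -> slid f' g x0 A a v.
Proof.
move=> e [h1 h2 h3 h4 h5 h6]; split=> //.
- by move=> i j ai ij; rewrite -!e; apply: h3.
- by move=> i ai; rewrite -!e; apply: h4.
- by rewrite -!e.
- by move=> i j off; rewrite -e; apply: h6.
Qed.

Lemma hook_col_endpoint n la a b T' H' :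
  is_partition n la -> b < head 0 la -> a < col_len la b -> state n la a b (T', H') ->
  let c := col_len la b in let g := padded la n.+1 (after a b) T' in
  exists e v u,
  [/\ in_diag la e /\ a <= e.1, is_back g a.+1 e.1.+1 v, v a.+1 = b.+1 /\ v e.1.+2 = e.2.+1,
      hget H' (e.1, b) = (e.2%:Z - b%:Z)%R /\ is_fwd g e.1.+1 u /\ u e.1.+1 = e.2.+1
    & (forall i, a <= i < e.1 -> (b.+1%:Z + hget H' (i, b) < (v i.+2)%:Z)%R) /\
      below_path b.+1 e.1.+2 c (hook_col H' b) u].
Proof.
move=> hla bh ac st c g; have ac' : a < c by []; have [/= tT so sH rH zH pH] := st.
have sn : sumn la = n by case/and3P: hla => _ _ /eqP.
have ab : in_diag la (a, b) by rewrite -(lt_col_len _ _ hla).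
case/(tabloidP _ sn): (tT) => eT rT iT.
have rT' x : in_diag la x -> 0 < get T' x < n.+1 by move=> /rT; lia.
have sg : sorted_grid n.+1 (head 0 la) a.+1 b.+1 g.
  by apply: padded_sorted hla bh rT' _ so.
have [w wA gw] := fwd_exists a b.+1 (sg_top sg) (sg_far sg).
have Jw := pH w gw wA.
have colb i : i < c -> in_diag la (i, b) by rewrite /c (lt_col_len _ _ hla).
have gd i j : 0 < g i j.+1 < n.+1 -> g i j.+1 <> g i.+1 j.
  case: i j => [|i] [|j]; rewrite /g /=; try by [case: ifP | lia].
    by case: ifP; lia.
  case: ifP => // _; case: ifP => [ij _|]; last lia.
  case: ifP => [_ e|_]; first by have := rT _ ij; lia.
  case: ifP => [ij' e|_ e]; last by have := rT _ ij; lia.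
  by case: (iT _ _ ij ij' e); lia.
(* The arm bound on the hooks puts every candidate not left of column [b] inside the diagram. *)
have JN i j : a.+1 <= i <= c -> (j%:Z = b.+1%:Z + hook_col H' b i)%R -> b.+1 <= j ->
    in_diag la (i.-1, j.-1).
  move=> ai ej bj; have ib := colb i.-1 ltac:(lia).
  have := rH _ ib; rewrite /after /= => /(_ ltac:(lia)).
  by have := arm_le ib; rewrite in_diagE; rewrite /hook_col in ej; lia.
have JN' i j : a.+1 <= i <= c -> (j%:Z = b.+1%:Z + hook_col H' b i)%R -> b.+1 <= j ->
    g i j < n.+1.
  move=> ai ej bj; have := JN i j ai ej bj.
  case: i j ai bj {ej} => [|i] [|j] ai bj //= ij.
  by rewrite /g /= ij; case: ifP => // _; have := rT _ ij; lia.
(* The bottom cell of a column has leg 0. *)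
have Jc : (0 <= hook_col H' b c)%R.
  have cb := colb c.-1 ltac:(lia).
  have := rH _ cb; rewrite /after /= /hook_col => /(_ ltac:(lia)).
  by rewrite /leg /= -/c; lia.
have [A' [v [u [aA [kv vA] vA' [gu ua] [lo hi]]]]] :=
  endpoint_exists (M := head 0 la) (A := a.+1) (B := b.+1) (c := c)
    ltac:(lia) ltac:(lia) sg gd gw wA Jw JN' Jc.
have vb : b.+1 <= v A'.+1 by rewrite -vA; apply: (back_le kv); lia.
have el := JN A' (v A'.+1) aA vA' vb.
have eA : A' = A'.-1.+1 by lia.
exists (A'.-1, (v A'.+1).-1), v, u; rewrite /= -!eA !prednK; try lia.
split=> //; first by split=> //; lia.
- by split=> //; rewrite /hook_col in vA'; lia.
- by split=> // i ia; have := lo i.+1 ltac:(lia).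
Qed.

Lemma path_in_diag n la a b e v (g : grid) i j : is_partition n la ->
  is_back g a.+1 e.1.+1 v -> v a.+1 = b.+1 -> v e.1.+2 = e.2.+1 -> in_diag la e ->
  on_path a.+1 e.1.+1 v i.+1 j.+1 -> [/\ in_diag la (i, j), a <= i <= e.1 & b <= j].
Proof.
move=> hla kv vA ve el /andP[ai /andP[vj jv]].
have vle k l : a < k -> k <= l -> l <= e.1.+2 -> v k <= v l by apply: (back_le kv).
have h1 := vle a.+1 i.+1 ltac:(lia) ltac:(lia) ltac:(lia).
have h2 := vle i.+2 e.1.+2 ltac:(lia) ltac:(lia) ltac:(lia).
split; [|lia|lia].
by rewrite (surjective_pairing e) in el; apply: in_diag_le hla el _ _; lia.
Qed.

Lemma padded_unslide n la N a b T' e v (g : grid) :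
  is_partition n la -> is_back g a.+1 e.1.+1 v -> v a.+1 = b.+1 -> v e.1.+2 = e.2.+1 ->
  in_diag la e -> a <= e.1 ->
  padded la N (after a.+1 b) (tabulate la (fun x => get T' (unslide_cell a b e v x))) =2
  unslide a.+1 b.+1 e.1.+1 v (padded la N (after a b) T').
Proof.
move=> hla kv vA ve el ae; set T := tabulate _ _.
have vle k l : a < k -> k <= l -> l <= e.1.+2 -> v k <= v l by apply: (back_le kv).
have on_in i j (on : on_path a.+1 e.1.+1 v i.+1 j.+1) := path_in_diag hla kv vA ve el on.
have gT x : in_diag la x -> get T x = get T' (unslide_cell a b e v x).
  exact: getT_tabulate.
have onab : on_path a.+1 e.1.+1 v a.+1 b.+1.
  by rewrite /on_path vA; have := vle a.+1 a.+2 ltac:(lia) ltac:(lia) ltac:(lia); lia.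
have soff i j : ~~ on_path a.+1 e.1.+1 v i.+1 j.+1 -> unslide_cell a b e v (i, j) = (i, j).
  move=> off; rewrite /unslide_cell /= (negbTE off).
  by case: eqP off => // -[-> ->]; rewrite onab.
  move=> i j; rewrite /unslide; case: i j => [|i] [|j] /=; rewrite /on_path ?ltn0 ?andbF //=.
    by case: (boolP (v i.+1 <= 0)) => // v0; have := vle a.+1 i.+1; case: ifP; lia.
  rewrite -/(on_path a.+1 e.1.+1 v i.+1 j.+1) !eqSS.
  case: (eqVneq (i, j) (a, b)) => [[-> ->]|ne].
    rewrite onab !eqxx /=.
    by have -> : after a.+1 b (a, b) = false by rewrite /after /=; lia.
  rewrite xpair_eqE in ne; rewrite (negbTE ne).
  have -> : after a.+1 b (i, j) = after a b (i, j) by rewrite /after /=; lia.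
  case: (boolP (on_path _ _ _ _ _)) => on; last first.
    by rewrite /=; case: ifP => // _; case: ifP => // ij; rewrite gT // soff.
  have [ij ai bj] := on_in _ _ on.
  have -> : after a b (i, j) by rewrite /after /=; lia.
  rewrite ij gT // /unslide_cell xpair_eqE (negbTE ne) /= on.
  case/andP: (on) => ai' /andP[vj jv].
  have vi := vle a.+1 i.+1 ltac:(lia) ltac:(lia) ltac:(lia).
  case: ifP => vj'.
    case: j on ij bj vj jv vj' {ne} => [|j] on ij bj vj jv vj'; first by lia.
    rewrite /=; have -> : after a b (i, j) by rewrite /after /=; lia.
    by rewrite (in_diag_le hla ij).
  have ia : a < i by case: (eqVneq i a) ne vj vj' => [->|]; rewrite ?vA /=; lia.
  case: i on ij ai ai' vj jv vj' ne vi ia => [//|i] on ij ai ai' vj jv vj' ne vi ia.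
  rewrite /=; have -> : after a b (i, j) by rewrite /after /=; lia.
  by rewrite (in_diag_le hla ij).
Qed.

(** The final cell is selected by [endpoint_exists], by way of [hook_col_endpoint]. The slide is
    undone along its backward path and the hooks are shifted back; then the invariant is checked for
    the result. *)
Lemma state_step_surj n la a b TH' :
  is_partition n la -> b < head 0 la -> a < col_len la b -> state n la a b TH' ->
  exists2 TH, state n la a.+1 b TH & nps_step la TH (a, b) = TH'.
Proof.
case: TH' => T' H' hla bh ac st; have [/= tT so sH rH zH pH] := st.
have [e [v [u [[el ae] kv [vA ve] [He [gu ue]] [lo hi]]]]] := hook_col_endpoint hla bh ac st.
have sn : sumn la = n by case/and3P: hla => _ _ /eqP.
have ab : in_diag la (a, b) by rewrite -(lt_col_len _ _ hla).
case/(tabloidP _ sn): (tT) => eT rT iT.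
have rT' x : in_diag la x -> 0 < get T' x < n.+1 by move=> /rT; lia.
have sg := padded_sorted hla bh rT' isT so.
set g := padded _ _ _ _ in kv gu sg.
have vle k l : a < k -> k <= l -> l <= e.1.+2 -> v k <= v l by apply: (back_le kv).
have be : b <= e.2 by have := vle a.+1 e.1.+2 ltac:(lia) ltac:(lia) ltac:(lia); lia.
have afe : after a b e by rewrite /after; lia.
have colb i : i <= e.1 -> in_diag la (i, b).
  by move=> ie; case: (e) el ie be => *; apply: in_diag_le hla _ _ _; eauto.
have ge : g e.1.+1 (v e.1.+2) = get T' e.
  by rewrite ve /g /= -surjective_pairing el afe.
have [] := unslide_slid (M := head 0 la) (A := a.+1) (B := b.+1) (a := e.1.+1)
  ltac:(lia) ltac:(lia) sg kv vA.
  by rewrite ge; have := rT _ el; lia.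
set f := unslide _ _ _ _ _; rewrite ge => sl sf.
have on_in i j (on : on_path a.+1 e.1.+1 v i.+1 j.+1) := path_in_diag hla kv vA ve el on.
pose s := unslide_cell a b e v.
have s_in x : in_diag la x -> in_diag la (s x).
  move=> xl; case: (boolP (on_path a.+1 e.1.+1 v x.1.+1 x.2.+1)) => on.
    have /= := unslide_cell_path kv vA ve on; rewrite -/(s x).
    by case: (s x) => i j /on_in[].
  by rewrite /s /unslide_cell (negbTE on); case: ifP.
have s_inj : injective s by apply: unslide_cell_inj kv ae vA ve.
pose T := tabulate la (fun x => get T' (s x)).
have gT x : in_diag la x -> get T x = get T' (s x) by apply: getT_tabulate.
have tT2 : is_tabloid la n T.
  apply/(tabloidP _ sn); split; first exact: map_size_tabulate.
    by move=> x xl; rewrite gT // rT // s_in.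
  by move=> x y xl yl; rewrite !gT // => /(iT _ _ (s_in _ xl) (s_in _ yl)) /s_inj.
have onab : on_path a.+1 e.1.+1 v a.+1 b.+1.
  by rewrite /on_path vA; have := vle a.+1 a.+2 ltac:(lia) ltac:(lia) ltac:(lia); lia.
have offout i j : ~~ after a b (i, j) -> ~~ on_path a.+1 e.1.+1 v i.+1 j.+1.
  by apply: contra => /on_in[_ ai bj]; rewrite /after /=; lia.
have sab : s (a, b) = e by rewrite /s /unslide_cell eqxx.
have soff i j : ~~ on_path a.+1 e.1.+1 v i.+1 j.+1 -> s (i, j) = (i, j).
  move=> off; rewrite /s /unslide_cell /= (negbTE off).
  by case: eqP off => // -[-> ->]; rewrite onab.
have fT : padded la n.+1 (after a.+1 b) T =2 f.
  exact: (padded_unslide _ _ hla kv vA ve el ae).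
have sf' : sorted_grid n.+1 (head 0 la) a.+2 b.+1 (padded la n.+1 (after a.+1 b) T).
  by apply: eq_sorted_grid sf => i j; rewrite fT.
have soT : sorted_after la a.+1 b T.
  apply: sorted_padded sf' => [x xl|i j i' j' ij]; last exact: in_diag_le hla ij.
  by rewrite gT // rT' // s_in.
(* The slide of the rebuilt filling and the slide that was undone move the same entry from the same
   cell of [f], so they coincide by [slid_unique]. *)
have [T2 [sT2 eT2]] : exists T2, T2 = (slide la T (a, b)).1 /\ slide la T (a, b) = (T', e).
  exists (slide la T (a, b)).1; split=> //.
  have := slide_slid hla bh ab tT2 soT; have := slide_tabloid sn ab tT2.
  have := slide_other (la := la) T (p := (a, b)).
  case: slide => T2 e2 /= oth tT3 [v2 [[v2A v2e] sl2 _ _ sg2]].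
  have sl1 : slid f (padded la n.+1 (after a b) T2) (get T' e) a.+1 e2.1.+1 v2.
    by rewrite gT // sab in sl2; apply: eq_slid sl2.
  have [ee eb eg] := slid_unique sl1 sl (etrans v2A (esym vA)).
  case: ee => ee; rewrite v2e ve in eb; case: eb => eb.
  congr pair; last by rewrite (surjective_pairing e2) ee eb -surjective_pairing.
  case/(tabloidP _ sn): tT3 => eT3 _ _.
  apply: (getT_ext (d := 0) eT3 eT) => -[i j] ij; rewrite -!/(get _ _).
  case: (boolP (after a b (i, j))) => aij; last first.
    rewrite oth ?gT ?soff ?offout //.
    by move: aij; rewrite /after /=; lia.
  by have := eg i.+1 j.+1; rewrite /g /= aij ij.
(* In column [b] the hooks of rows [a.+1] to [e.1] are shifted back down, and those of the
   unprocessed rows are reset to 0. *)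
pose K x := if x.2 != b then hget H' x else if x.1 <= a then 0%R
  else if x.1 <= e.1 then (hget H' (x.1.-1, b) + 1)%R else hget H' x.
pose H := tabulate la K.
have gH x : in_diag la x -> hget H x = K x by apply: getT_tabulate.
have uH : hook_update H (a, b) e = H'.
  rewrite [e in LHS](surjective_pairing e); apply: (getT_ext (d := 0%R) _ sH).
    by apply: map_size_update => [|i ia|//]; [exact: map_size_tabulate|apply: colb; lia].
  move=> [i j] ij; rewrite -!/(hget _ _) hget_update //.
  case: (eqVneq j b) ij => [->|jb] ij /=; last by rewrite gH // /K /= jb.
  case: (eqVneq i e.1) => [->|ie]; first by rewrite He.
  case: ifP => iaa.
    rewrite gH; last by apply: colb; lia.
    rewrite /K /= eqxx /=; have -> : i < a = false by lia.
    by have -> : i < e.1 by [lia]; rewrite GRing.addrK.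
  rewrite gH // /K /= eqxx /=; case: (leqP i a) => ia'.
    by rewrite zH // /after /=; lia.
  by have -> : i <= e.1 = false by lia.
exists (T, H); last by rewrite /nps_step eT2 uH.
split=> //=.
- exact: map_size_tabulate.
- move=> [i j] ij aij; rewrite gH // /K /=.
  case: (eqVneq j b) ij aij => [->|jb] ij aij /=; last first.
    by apply: rH => //; move: aij; rewrite /after /=; lia.
  have -> : i <= a = false by move: aij; rewrite /after /=; lia.
  case: ifP => ie; last by apply: rH => //; move: aij; rewrite /after /=; lia.
  (* Adding one keeps the hook within the arm: the candidate of row [i.-1] is strictly left of the
     backward path, and the diagram contains the cell just before the column where the path leaves
     row [i]. The leg drops by one from row [i.-1] to row [i]. *)
  clear - hla rH lo vle on_in ij aij ie kv colb vA.
  have ai : a < i by move: aij; rewrite /after /=; lia.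
  have := rH (i.-1, b) (colb _ _) _; rewrite /after /= => /(_ ltac:(lia) ltac:(lia)).
  have := lo i.-1 ltac:(lia); rewrite prednK; last lia.
  have vi := vle i.+1 e.1.+2 ltac:(lia) ltac:(lia) ltac:(lia).
  have [on _ _] : [/\ in_diag la (i, (v i.+1).-1), a <= i <= e.1 & b <= (v i.+1).-1].
    apply: on_in; rewrite prednK; last by have := vle a.+1 i.+1; lia.
    by rewrite /on_path; have := back_mono kv (i := i.+1); lia.
  have := arm_le on; rewrite in_diagE in on; have := arm_le ij.
  have := ij; rewrite -(lt_col_len _ _ hla) /leg /=.
  have := vle a.+1 i.+1 ltac:(lia) ltac:(lia) ltac:(lia).
  lia.
- move=> [i j] ij aij; rewrite gH // /K /=.
  case: (eqVneq j b) aij ij => [->|jb] aij ij /=; last first.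
    by apply: zH => //; move: aij; rewrite /after /=; lia.
  by have -> : i <= a by move: aij; rewrite /after /=; lia.
- move=> u1 fu1 u1A.
  (* The forward path of the rebuilt filling follows [v] down to [e] and then [u]; the two
     properties of the selected candidate bound the hooks along these two parts. *)
  have fu0 := fwd_of_slid sl gu; rewrite ue -ve in fu0; have {}fu0 := fu0 erefl.
  have le i : a < i -> (if i <= e.1.+1 then v i else u i) <= u1 i.
    apply: (fwd_compare fu1 fu0) => [|j _|k l _]; try exact: fT.
    by rewrite u1A ltnS ae vA.
  clear - hla ac rH colb lo hi gH le el be.
  move=> i ai; have := le i ltac:(lia); rewrite /hook_col.
  have ib : in_diag la (i.-1, b) by rewrite -(lt_col_len _ _ hla); lia.
  rewrite gH // /K /= eqxx /=; have -> : i.-1 <= a = false by lia.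
  case: (leqP i.-1 e.1) => ie.
    have -> : i <= e.1.+1 by lia.
    have := lo i.-2 ltac:(lia); have -> : i.-2.+2 = i by lia.
    by lia.
  have -> : i <= e.1.+1 = false by lia.
  by have := hi i ltac:(lia); rewrite /hook_col; lia.
Qed.

(** * The Novelli-Pak-Stoyanovskii bijection *)

Lemma after_next n la b i j : is_partition n la -> in_diag la (i, j) ->
  after (col_len la b) b (i, j) = after 0 b.+1 (i, j).
Proof.
move=> hla ij; have := ij; rewrite -(lt_col_len _ _ hla) /after /=.
by case: (eqVneq j b) => [->|]; lia.
Qed.

Lemma sorted_next n la b T : is_partition n la ->
  sorted_after la (col_len la b) b T <-> sorted_after la 0 b.+1 T.
Proof.
move=> hla; split=> so i j aij; split=> ij.
- have ij' : in_diag la (i, j) := in_diag_le hla ij (leqnn _) (leqnSn _).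
  by rewrite -(after_next b hla ij') in aij; case: (so _ _ aij) => + _; apply.
- have ij' : in_diag la (i, j) := in_diag_le hla ij (leqnSn _) (leqnn _).
  by rewrite -(after_next b hla ij') in aij; case: (so _ _ aij) => _; apply.
- have ij' : in_diag la (i, j) := in_diag_le hla ij (leqnn _) (leqnSn _).
  by rewrite (after_next b hla ij') in aij; case: (so _ _ aij) => + _; apply.
- have ij' : in_diag la (i, j) := in_diag_le hla ij (leqnSn _) (leqnn _).
  by rewrite (after_next b hla ij') in aij; case: (so _ _ aij) => _; apply.
Qed.

(* When a whole column is processed the path condition is vacuous: the forward
   path runs along the padding row to the end of the first row. *)
Lemma path_top n la b T H u : is_partition n la -> b < head 0 la ->
  is_tabloid la n T ->
  (forall x, in_diag la x -> after 0 b x -> (hget H x <= (arm la x)%:Z)%R) ->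
  is_fwd (padded la n.+1 (after 0 b) T) 0 u -> u 0 = b.+1 ->
  below_path b.+1 1 (col_len la b) (hook_col H b) u.
Proof.
move=> hla bh tT rH fu u0 [//|i] ic.
have sn : sumn la = n by case/and3P: hla => _ _ /eqP.
case/(tabloidP _ sn): tT => _ rT _.
have [u01 _ u03] := fu 0 isT; rewrite u0 in u01.
have hu : head 0 la <= u 1.
  rewrite leqNgt; apply/negP => lt; case: (u 1) u01 lt u03 => [//|j] bj jh /=.
  rewrite jh leqn0; have -> : after 0 b (0, j) by rewrite /after /=; lia.
  by case: ifP => [/rT|]; lia.
have := fwd_mono fu (i := 1) (j := i.+1) isT.
have ib : in_diag la (i, b) by rewrite -(lt_col_len _ _ hla).
have := rH _ ib; rewrite /after /= eqxx orbT => /(_ isT).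
have := arm_le ib; have := nth_partition hla (leq0n i).
by rewrite nth0 /hook_col /=; lia.
Qed.

(** Only the path condition differs in substance: at the end of column [b] its range of rows is
    empty, and at the top of column [b.+1] it holds by [path_top]. *)
Lemma state_next n la b TH : is_partition n la -> b.+1 < head 0 la ->
  state n la (col_len la b) b TH <-> state n la 0 b.+1 TH.
Proof.
move=> hla bh; split=> -[tT so sH rH zH pH]; split=> //.
- exact/(sorted_next b _ hla).
- by move=> [i j] ij aij; apply: rH; rewrite // (after_next b hla).
- by move=> [i j] ij aij; apply: zH; rewrite // (after_next b hla).
- move=> u fu u0; apply: (path_top hla bh tT) fu u0 => -[i j] ij aij.
  by have := rH (i, j) ij; rewrite (after_next b hla ij) => /(_ aij)/andP[].
- exact/(sorted_next b _ hla).
- by move=> [i j] ij aij; apply: rH; rewrite // -(after_next b hla).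
- by move=> [i j] ij aij; apply: zH; rewrite // -(after_next b hla).
- by move=> u fu u0 i; lia.
Qed.

Lemma after_last n la b i j : is_partition n la -> head 0 la = b.+1 ->
  in_diag la (i, j) -> ~~ after (col_len la b) b (i, j).
Proof.
move=> hla bh ij; have := in_diag_head hla ij; have := ij.
rewrite -(lt_col_len _ _ hla) /after /=.
by case: (eqVneq j b) => [->|]; lia.
Qed.

Lemma map_size_H0 la : map size (H0 la) = la.
Proof. by rewrite /H0 -map_comp -[RHS]map_id; apply: eq_map => r /=; rewrite size_nseq. Qed.

Lemma hget_H0 la x : hget (H0 la) x = 0%R.
Proof.
rewrite /hget /getT /H0; case: (ltnP x.1 (size la)) => xs.
  by rewrite (nth_map 0) // nth_nseq if_same.
by rewrite (nth_default [::]) ?size_map // nth_nil.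
Qed.

Lemma state_last n la b T H : is_partition n la -> head 0 la = b.+1 ->
  state n la (col_len la b) b (T, H) <-> is_tabloid la n T /\ H = H0 la.
Proof.
move=> hla bh; split=> [[/= tT so sH rH zH pH]|[tT ->]].
  split=> //; apply: (getT_ext (d := 0%R) sH (map_size_H0 la)) => -[i j] ij.
  by rewrite -!/(hget _ _) hget_H0; apply: zH => //; apply: after_last hla bh ij.
split=> //=.
- move=> i j aij; split=> ij.
    have := after_last hla bh (in_diag_le hla ij (leqnn _) (leqnSn _)).
    by rewrite aij.
  have := after_last hla bh (in_diag_le hla ij (leqnSn _) (leqnn _)).
  by rewrite aij.
- exact: map_size_H0.
- by move=> [i j] ij; rewrite (negbTE (after_last hla bh ij)).
- by move=> x _ _; apply: hget_H0.
- by move=> u _ _ i; lia.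
Qed.

(** [foldr] treats the last cell of [s] first, as the algorithm does. *)
Definition nps_suffix (la : seq nat) (TH : tab * htab) (s : seq cell) : tab * htab :=
  foldr (fun z TH => nps_step la TH z) TH s.

Definition slides (la : seq nat) (T : tab) (s : seq cell) : tab :=
  foldr (fun z T => (slide la T z).1) T s.

Lemma nps_suffix_slides la T H s : (nps_suffix la (T, H) s).1 = slides la T s.
Proof.
elim: s => [//|z s /= <-]; rewrite /nps_step.
by case: (slide la _ z).
Qed.

Lemma state_suffix n la a b T : is_partition n la -> b < head 0 la -> a <= col_len la b ->
  is_tabloid la n T -> state n la a b (nps_suffix la (T, H0 la) (suffix_cells la a b)).
Proof.
move=> hla bh ac tT.
apply: (suffix_cells_ind (P := fun a b =>
  state n la a b (nps_suffix la (T, H0 la) (suffix_cells la a b)))) bh ac.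
- by move=> b' bh; rewrite suffix_cells_last //; apply/(state_last _ _ hla bh).
- by move=> b' bh st; rewrite suffix_cells_next //; apply/(state_next _ hla bh).
- by move=> a' b' bh ac st; rewrite suffix_cells_cons //; apply: state_step.
Qed.

Lemma nps_suffix_inj n la a b T1 T2 :
  is_partition n la -> b < head 0 la -> a <= col_len la b ->
  is_tabloid la n T1 -> is_tabloid la n T2 ->
  nps_suffix la (T1, H0 la) (suffix_cells la a b) =
  nps_suffix la (T2, H0 la) (suffix_cells la a b) -> T1 = T2.
Proof.
move=> hla bh ac t1 t2.
apply: (suffix_cells_ind (P := fun a b => nps_suffix la (T1, H0 la) (suffix_cells la a b) =
  nps_suffix la (T2, H0 la) (suffix_cells la a b) -> T1 = T2)) bh ac.
- by move=> b' bh; rewrite suffix_cells_last // => -[].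
- by move=> b' bh; rewrite suffix_cells_next.
- move=> a' b' bh ac IH; rewrite suffix_cells_cons //= => e; apply: IH.
  exact: state_step_inj hla bh ac (state_suffix hla bh ac t1) (state_suffix hla bh ac t2) e.
Qed.

Lemma nps_suffix_surj n la a b TH :
  is_partition n la -> b < head 0 la -> a <= col_len la b -> state n la a b TH ->
  exists2 T, is_tabloid la n T & nps_suffix la (T, H0 la) (suffix_cells la a b) = TH.
Proof.
move=> hla bh ac; move: TH.
apply: (suffix_cells_ind (P := fun a b => forall TH, state n la a b TH ->
  exists2 T, is_tabloid la n T & nps_suffix la (T, H0 la) (suffix_cells la a b) = TH)) bh ac.
- move=> b' bh [T H] /(state_last _ _ hla bh)[tT ->].
  by exists T; rewrite // suffix_cells_last.
- by move=> b' bh IH TH /(state_next _ hla bh)/IH; rewrite suffix_cells_next.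
- move=> a' b' bh ac IH TH /(state_step_surj hla bh ac)[TH1 /IH[T tT e] <-].
  by exists T; rewrite // suffix_cells_cons //= e.
Qed.

(** With all cells processed, the path condition follows from the bounds on the hooks by
    [path_top]. *)
Lemma state_final n la T H : is_partition n la -> 0 < head 0 la ->
  state n la 0 0 (T, H) <-> is_SYT la n T /\ is_hook_tableau la H.
Proof.
move=> hla h; have af x : after 0 0 x by rewrite /after; lia.
split=> [[/= tT so sH rH zH pH]|[/and3P[tT /allP sr /allP sd] /andP[/eqP sH /allP rH]]].
  split.
    apply/and3P; split=> //; apply/allP => -[i j] _; apply/implyP => ij.
      by case: (so i j (af _)) => + _; apply.
    by case: (so i j (af _)) => _; apply.
  apply/andP; split; first exact/eqP.
  by apply/allP => x; rewrite (mem_cells _ hla) => xl; apply: rH.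
have rH' x : in_diag la x -> (- (leg la x)%:Z <= hget H x <= (arm la x)%:Z)%R.
  by rewrite -(mem_cells _ hla) => /rH.
split=> //=.
- move=> i j _; split=> ij.
    have ij' := in_diag_le hla ij (leqnn _) (leqnSn _).
    by rewrite -(mem_cells _ hla) in ij'; have /implyP := sr _ ij'; apply.
  have ij' := in_diag_le hla ij (leqnSn _) (leqnn _).
  by rewrite -(mem_cells _ hla) in ij'; have /implyP := sd _ ij'; apply.
- by move=> x xl _; apply: rH'.
- by move=> x _; rewrite af.
- by move=> u fu u0; apply: (path_top hla h tT) fu u0 => x /rH' /andP[].
Qed.

(** The algorithm omits the last cell, while [suffix_cells] contains it. Its slide moves nothing and
    its hook update writes 0, so the results agree. *)
Lemma nps_run_suffix n la T a b : is_partition n la -> in_diag la (a, b) ->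
  nps_run la T (index (a, b) (cells la)) =
  nps_suffix la (T, H0 la) (suffix_cells la a b).
Proof.
move=> hla ab; have bh := in_diag_head hla ab.
have ac : a < col_len la b by rewrite (lt_col_len _ _ hla).
(* [(c, h)] is the last cell of the order, the bottom of the last column. *)
pose h := (head 0 la).-1; pose c := (col_len la h).-1.
have hh : h < head 0 la by rewrite /h; lia.
have zl : in_diag la (c, h).
  rewrite -(lt_col_len _ _ hla) /c prednK //.
  rewrite (lt_col_len _ _ hla) in_diagE nth0; exact: hh.
have cl : c < col_len la h by rewrite (lt_col_len _ _ hla).
have [s e _] := cells_split hh (ltnW cl).
rewrite suffix_cells_cons // in e.
have ec : c.+1 = col_len la h by rewrite /c prednK // (leq_ltn_trans _ cl).
rewrite ec suffix_cells_last in e; last by rewrite /h; lia.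
rewrite -(drop_index_cells bh ac) /nps_run.
set p := index _ _; have ps : p < size (cells la) by rewrite index_mem (mem_cells _ hla).
rewrite {}e cats1 size_rcons -cats1 take_size_cat //= in ps *.
have -> : drop p (s ++ [:: (c, h)]) = rcons (drop p s) (c, h).
  rewrite drop_cat; case: ltnP => sp; first by rewrite cats1.
  have -> : p = size s by lia.
  by rewrite subnn drop_size.
rewrite /nps_suffix foldl_rev foldr_rcons; congr foldr.
have out i j : (c < i) || (h < j) -> h <= j -> in_diag la (i, j) = false.
  move=> ij hj; apply/negP => il; have := in_diag_head hla il => jh.
  have ej : j = h by rewrite /h in hj *; lia.
  by rewrite ej -(lt_col_len _ _ hla) -ec in il; rewrite ej in ij; lia.
have -> : nps_step la (T, H0 la) (c, h) = (T, hook_update (H0 la) (c, h) (c, h)).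
  rewrite /nps_step /slide /=; case: (sumn la) => [//|f] /=.
  by rewrite !out //; lia.
congr pair; apply: (getT_ext (d := 0%R) (map_size_H0 la)).
  apply: map_size_update => //; first exact: map_size_H0.
  by move=> i ic; have -> : i = c by lia.
move=> [i j] _; rewrite -!/(hget _ _) hget_update // !hget_H0.
case: (j != h) => //; case: (i == c); first by rewrite GRing.subrr.
by have -> : c <= i < c = false by lia.
Qed.

Lemma Phi_suffix n la T : is_partition n la -> 0 < head 0 la ->
  Phi la T = let: (U, H) := nps_suffix la (T, H0 la) (suffix_cells la 0 0) in (H, U).
Proof.
move=> hla h; have z : in_diag la (0, 0) by rewrite in_diagE nth0.
rewrite -(nps_run_suffix T hla z) /Phi; congr (let: (U, H) := nps_run la T _ in (H, U)).
have c0 : 0 < col_len la 0 by rewrite (lt_col_len _ _ hla).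
by rewrite cells_suffix // suffix_cells_cons //= eqxx.
Qed.

(** * Small and large entries *)

(** Replacing all large entries by [k] forgets their arrangement and keeps everything else. *)
Definition trunc (k : nat) (T : tab) : tab := [seq [seq minn k t | t <- r] | r <- T].

Lemma get_trunc k T x : get (trunc k T) x = minn k (get T x).
Proof.
rewrite /get /getT /trunc; case: (ltnP x.1 (size T)) => xs; last first.
  by rewrite !(nth_default [::]) ?size_map // nth_nil minn0.
rewrite (nth_map [::]) //; case: (ltnP x.2 (size (nth [::] T x.1))) => xs'.
  by rewrite (nth_map 0).
by rewrite [LHS]nth_default ?size_map // [nth _ _ x.2]nth_default // minn0.
Qed.

Lemma map_size_trunc k T : map size (trunc k T) = map size T.
Proof. by rewrite -map_comp; apply: eq_map => r /=; rewrite size_map. Qed.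

Lemma trunc_ext la k T T' : map size T = la -> map size T' = la ->
  (forall x, in_diag la x -> minn k (get T x) = minn k (get T' x)) ->
  trunc k T = trunc k T'.
Proof.
move=> eT eT' e; apply: (getT_ext (d := 0) (la := la)); rewrite ?map_size_trunc //.
by move=> x xl; rewrite -!/(get _ _) !get_trunc e.
Qed.

Lemma trunc_swap la k T p q : map size T = la -> in_diag la p -> in_diag la q ->
  trunc k (swapT T p q) = swapT (trunc k T) p q.
Proof.
move=> eT pl ql; apply: (getT_ext (d := 0) (la := la)).
- by rewrite map_size_trunc; apply: map_size_swap.
- by apply: map_size_swap; rewrite ?map_size_trunc.
- move=> x xl; rewrite -!/(get _ _) get_trunc !get_swap !get_trunc.
  by case: ifP => // _; case: ifP.
Qed.

(* A large entry first moves through the small ones exactly as [k] would, and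
   then only through large ones; hence the final cells need not agree above [k]. *)
Lemma slide_aux_trunc la N k fuel T p : map size T = la -> in_diag la p ->
  (forall x, in_diag la x -> get T x < N) ->
  (forall i j, p.1 <= i -> p.2 <= j -> (i, j) != p ->
     (in_diag la (i, j.+1) -> get T (i, j) < get T (i, j.+1)) /\
     (in_diag la (i.+1, j) -> get T (i, j) < get T (i.+1, j))) ->
  let: (T', e) := slide_aux fuel la T p in
  let: (S', e') := slide_aux fuel la (trunc k T) p in
  S' = trunc k T' /\ (get T p <= k -> e' = e).
Proof.
elim: fuel T p => [//|f IH] T p eT pl TN so.
have SN x : in_diag la x -> get (trunc k T) x < N.
  by move=> /TN; rewrite get_trunc; lia.
rewrite (slide_auxS f pl TN) (slide_auxS f pl SN) /=.
rewrite -!surjective_pairing pl !get_trunc.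
(* If the chosen neighbour [q] is large, so is the entry exchanged with it, and truncation hides the
   exchange. The right and lower neighbours of [q] are large too, so a truncated slide at [q] stops
   at once. *)
have stay q : in_diag la q -> k <= get T q -> q = (p.1, p.2.+1) \/ q = (p.1.+1, p.2) ->
    get T q < get T p -> forall g, slide_aux g la (trunc k (swapT T p q)) q =
      (trunc k (swapT T p q), q) /\ trunc k (swapT T p q) = trunc k T.
  move=> ql kq pq lt g; split; last first.
    apply: (trunc_ext (map_size_swap eT pl ql) eT) => x xl.
    by rewrite get_swap; case: eqP => [->|_]; [|case: eqP => [->|//]]; lia.
  case: g => [//|g]; rewrite (slide_auxS (N := N)) //; last first.
    move=> x xl; rewrite get_trunc get_swap.
    by have := TN _ xl; have := TN _ pl; have := TN _ ql; case: ifP => _; [|case: ifP => _]; lia.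
  rewrite /= -!surjective_pairing ql !get_trunc !get_swap eqxx.
  have nb r : (r == q) = false -> (r == p) = false -> in_diag la r ->
      (in_diag la r -> get T q < get T r) ->
      minn k (if r == q then get T p else if r == p then get T q else get T r) = k.
    by move=> -> -> rl /(_ rl); lia.
  have [r1 r2] := so q.1 q.2 ltac:(by case: pq => ->; rewrite /=; lia)
    ltac:(by case: pq => ->; rewrite /=; lia) ltac:(by rewrite -surjective_pairing;
      case: pq => ->; case: (p) => i j; rewrite xpair_eqE /=; lia).
  rewrite -surjective_pairing in r1 r2.
  have q1 : ((q.1, q.2.+1) == q) = false.
    by apply/eqP => /(congr1 (fun x => x.1 + x.2)) /=; lia.
  have q2 : ((q.1.+1, q.2) == q) = false.
    by apply/eqP => /(congr1 (fun x => x.1 + x.2)) /=; lia.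
  have p1 : ((q.1, q.2.+1) == p) = false.
    by apply/eqP => /(congr1 (fun x => x.1 + x.2)) /=; case: pq => -> /=; lia.
  have p2 : ((q.1.+1, q.2) == p) = false.
    by apply/eqP => /(congr1 (fun x => x.1 + x.2)) /=; case: pq => -> /=; lia.
  have kN : k < N by have := TN _ ql; lia.
  have -> : minn k (get T p) = k by lia.
  case: (boolP (in_diag la (q.1, q.2.+1))) => l1;
    case: (boolP (in_diag la (q.1.+1, q.2))) => l2.
  - by rewrite !nb // ltnn !andbF.
  - by rewrite !nb // ltnn (ltnNge N k) (ltnW kN) !andbF.
  - by rewrite !nb // ltnn (ltnNge N k) (ltnW kN) !andbF.
  - by rewrite (ltnNge N k) (ltnW kN) !andbF.
have go q : in_diag la q -> q = (p.1, p.2.+1) \/ q = (p.1.+1, p.2) ->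
    get T q < get T p ->
    let: (T', e) := slide_aux f la (swapT T p q) q in
    let: (S', e') := slide_aux f la (trunc k (swapT T p q)) q in
    S' = trunc k T' /\ (get T p <= k -> e' = e).
  move=> ql pq lt; have := IH (swapT T p q) q (map_size_swap eT pl ql) ql.
  rewrite get_swap eqxx; apply=> [x xl|i j qi qj ne].
    by rewrite get_swap; case: ifP => _; [|case: ifP => _]; apply: TN.
  have [|||s1 s2] := so i j.
  - by case: pq qi => -> /=; lia.
  - by case: pq qj => -> /=; lia.
  - apply/eqP => eij; rewrite -eij in pq; case: pq qi qj => -> /=; lia.
  have np x : x.1 + x.2 > p.1 + p.2 -> (x == p) = false.
    by move=> h; apply/eqP => e; rewrite e ltnn in h.
  have nq x : x.1 + x.2 > q.1 + q.2 -> (x == q) = false.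
    by move=> h; apply/eqP => e; rewrite e ltnn in h.
  have pq' : p.1 + p.2 < q.1 + q.2 by case: pq => -> /=; lia.
  by split=> ij; rewrite !get_swap (negbTE ne) !np ?(nq (_, _)) //=; auto; lia.
have tp : get T p < N := TN _ pl.
set r := (p.1, p.2.+1) in stay go *; set d := (p.1.+1, p.2) in stay go *.
have finish q : in_diag la q -> q = r \/ q = d -> get T q < get T p -> 
    let: (T', e) := slide_aux f la (swapT T p q) q in
    let: (S', e') := if get T q < k then slide_aux f la (swapT (trunc k T) p q) q
                     else (trunc k T, p) in
    S' = trunc k T' /\ (get T p <= k -> e' = e).
  move=> ql pq lt; have := go q ql pq lt.
  case: ltnP => kq; first by rewrite (trunc_swap k eT pl ql).
  have [-> tr] := stay q ql kq pq lt f.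
  by case: slide_aux => T' e [<- _]; split; [rewrite tr|lia].
have rN := TN r; have dN := TN d.
case: ifP => [/andP[rd rp]|nr].
  have rl : in_diag la r by case: ifP rp => //; lia.
  have := finish r rl (or_introl erefl); rewrite rl in rd rp *; rewrite rp => /(_ isT).
  case: slide_aux => T' e; have rNl := rN rl.
  case: (ltnP (get T r) k) => kr.
    have -> : (get T r < if in_diag la d then minn k (get T d) else N) &&
        (get T r < minn k (get T p)) by case: ifP rd; lia.
    by [].
  have -> : (k < minn k (get T p)) = false by lia.
  rewrite andbF; case: ifP => // /andP[_].
  by case: ifP rd; lia.
case: ifP => [/andP[dr dp]|nd].
  have dl : in_diag la d by case: ifP dp => //; lia.
  have := finish d dl (or_intror erefl); rewrite dl in nr dr dp *; rewrite dp => /(_ isT).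
  case: slide_aux => T' e; have dNl := dN dl.
  case: (ltnP (get T d) k) => kd.
    have -> : (if in_diag la r then minn k (get T r) else N) < get T d = false.
      by case: ifP dr; lia.
    have -> : (get T d <= if in_diag la r then minn k (get T r) else N) &&
        (get T d < minn k (get T p)) by case: ifP dr; lia.
    by [].
  have -> : (k < minn k (get T p)) = false by lia.
  rewrite andbF; case: ifP => // /andP[_].
  by case: ifP dr; lia.
have -> : ((if in_diag la r then minn k (get T r) else N) <
    if in_diag la d then minn k (get T d) else N) &&
    ((if in_diag la r then minn k (get T r) else N) < minn k (get T p)) = false.
  by case: ifP nr nd => rl; case: ifP => dl; try have := rN rl; try have := dN dl; lia.
have -> : ((if in_diag la d then minn k (get T d) else N) <=
    if in_diag la r then minn k (get T r) else N) &&
    ((if in_diag la d then minn k (get T d) else N) < minn k (get T p)) = false.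
  by case: ifP nr nd => rl; case: ifP => dl; try have := dN rl; try have := rN dl; lia.
by [].
Qed.

Lemma slide_trunc n la k a b T : is_partition n la -> in_diag la (a, b) ->
  is_tabloid la n T -> sorted_after la a.+1 b T ->
  (slide la (trunc k T) (a, b)).1 = trunc k (slide la T (a, b)).1 /\
  (get T (a, b) <= k -> (slide la (trunc k T) (a, b)).2 = (slide la T (a, b)).2).
Proof.
move=> hla ab tT so; have sn : sumn la = n by case/and3P: hla => _ _ /eqP.
case/(tabloidP T sn): tT => eT rT _.
have TN x : in_diag la x -> get T x < n.+1 by move=> /rT; lia.
have := @slide_aux_trunc la n.+1 k (sumn la) T (a, b) eT ab TN; rewrite -!/(slide _ _ _).
case: (slide la T _) => T' e; case: (slide la (trunc k T) _) => S' e' /=; apply.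
move=> i j ai bj; rewrite xpair_eqE => ne; apply: so.
by rewrite /after /=; lia.
Qed.

(** An entry [k] changes places only with entries below [k]. So the other cells of value [k] are not
    touched, and the final cell is the start or a cell whose entry was below [k]. *)
Lemma slide_level la k T p : in_diag la p -> get T p = k ->
  let: (T', e) := slide la T p in
  (forall y, (get T' y == k) = (y == e) || (y != p) && (get T y == k)) /\
  (e = p \/ get T e < k).
Proof.
move=> pl; rewrite /slide; apply: (slide_aux_ind (R := fun T p r => get T p = k ->
  let: (T', e) := r in
  (forall y, (get T' y == k) = (y == e) || (y != p) && (get T y == k)) /\
  (e = p \/ get T e < k))) pl => [{}T {}p pl pk|].
  split=> [y|]; last by left.
  by case: (eqVneq y p) => [->|//]; rewrite pk eqxx.
move=> {}T {}p q [T' e] pl ql pq lt IH pk.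
have [] := IH _; first by rewrite get_swap eqxx.
move=> lev ek; have ne : p != q by case: pq => ->; case: (p) => i j; rewrite xpair_eqE /=; lia.
split=> [y|].
  rewrite lev get_swap; case: (y == e) => //=.
  case: (eqVneq y q) => [->|_] /=; first by rewrite (ltn_eqF _) ?andbF // -pk.
  by case: (eqVneq y p) => [->|//] /=; rewrite ltn_eqF // -pk.
case: ek => [->|]; first by right; rewrite -pk.
rewrite get_swap; case: eqP => [->|_]; first by right; rewrite -pk.
by case: eqP => [->|_]; [left|right].
Qed.

Lemma slide_below_level la k T p : in_diag la p -> get T p < k ->
  forall y, (get (slide la T p).1 y == k) = (get T y == k).
Proof.
move=> pl; rewrite /slide; apply: (slide_aux_ind (R := fun T p r => get T p < k ->
  forall y, (get r.1 y == k) = (get T y == k))) pl => [//|].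
move=> {}T {}p q [T' e] pl ql _ lt IH pk y.
rewrite IH get_swap ?eqxx //; case: (eqVneq y q) => [->|_].
  by rewrite !ltn_eqF //; apply: ltn_trans lt pk.
by case: (eqVneq y p) => [->|//]; rewrite !ltn_eqF //; apply: ltn_trans lt pk.
Qed.

Lemma slides_before n la a b T : is_partition n la -> b < head 0 la -> a <= col_len la b ->
  forall y, ~~ after a b y -> in_diag la y -> get (slides la T (suffix_cells la a b)) y = get T y.
Proof.
move=> hla; apply: (suffix_cells_ind (P := fun a b => forall y, ~~ after a b y ->
  in_diag la y -> get (slides la T (suffix_cells la a b)) y = get T y)).
- by move=> b' bh y _ _; rewrite suffix_cells_last.
- move=> b' bh IH [i j] na yl; rewrite suffix_cells_next // IH //.
  by rewrite -(after_next b' hla yl).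
- move=> a' b' bh ac IH y na yl; rewrite suffix_cells_cons //=.
  rewrite slide_other -?(lt_col_len _ _ hla) //; last by move: na; rewrite /after /=; lia.
  by rewrite IH //; move: na; rewrite /after; lia.
Qed.

Lemma trunc_slides n la k a b T : is_partition n la -> b < head 0 la -> a <= col_len la b ->
  is_tabloid la n T ->
  slides la (trunc k T) (suffix_cells la a b) = trunc k (slides la T (suffix_cells la a b)).
Proof.
move=> hla bh ac tT.
apply: (suffix_cells_ind (P := fun a b => slides la (trunc k T) (suffix_cells la a b) =
  trunc k (slides la T (suffix_cells la a b)))) bh ac.
- by move=> b' bh; rewrite suffix_cells_last.
- by move=> b' bh IH; rewrite suffix_cells_next.
- move=> a' b' bh ac IH; rewrite suffix_cells_cons //= IH.
  have [tT' so _ _ _ _] := state_suffix hla bh ac tT.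
  rewrite nps_suffix_slides in tT' so.
  by have [] := slide_trunc k hla _ tT' so; rewrite -?(lt_col_len _ _ hla).
Qed.

(** For [S = trunc k T] and a large cell [z] this is the map [X]. It is computed from the truncated
    filling, hence independent of how the large entries are arranged. *)
Definition slide_end_at (la : seq nat) (S : tab) (z : cell) : cell :=
  (slide la (slides la S (suffix_cells la z.1.+1 z.2)) z).2.

(** Induction over the processed cells, the cells of value [k] among them being the final cells
    found so far. A slide of a smaller entry leaves this set unchanged; a slide of [k] adds its own
    final cell. *)
Lemma slide_end_at_bij n la k S a b : is_partition n la ->
  (forall x, in_diag la x -> get S x <= k) -> b < head 0 la -> a <= col_len la b ->
  let s := suffix_cells la a b in
  [/\ forall w, w \in s -> get S w = k ->
        slide_end_at la S w \in s /\ get (slides la S s) (slide_end_at la S w) = k,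
      forall y, y \in s -> get (slides la S s) y = k ->
        exists w, [/\ w \in s, get S w = k & slide_end_at la S w = y]
    & forall w w', w \in s -> w' \in s -> get S w = k -> get S w' = k ->
        slide_end_at la S w = slide_end_at la S w' -> w = w'].
Proof.
move=> hla Sk; apply: (suffix_cells_ind (P := fun a b => let s := suffix_cells la a b in
  [/\ forall w, w \in s -> get S w = k ->
        slide_end_at la S w \in s /\ get (slides la S s) (slide_end_at la S w) = k,
      forall y, y \in s -> get (slides la S s) y = k ->
        exists w, [/\ w \in s, get S w = k & slide_end_at la S w = y]
    & forall w w', w \in s -> w' \in s -> get S w = k -> get S w' = k ->
        slide_end_at la S w = slide_end_at la S w' -> w = w'])).
- by move=> b' bh /=; rewrite suffix_cells_last.
- by move=> b' bh; rewrite /= suffix_cells_next.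
- move=> {}a {}b bh ac /=; have ab : in_diag la (a, b) by rewrite -(lt_col_len _ _ hla).
  rewrite (suffix_cells_cons ac) /=; set s := suffix_cells la a.+1 b; set R := slides la S s.
  move=> [IH1 IH2 IH3].
  have zs : (a, b) \notin s.
    by rewrite (mem_suffix_cells _ _ _ hla) /after /=; lia.
  have Rz : get R (a, b) = get S (a, b).
    by apply: (slides_before _ hla) => //; rewrite /after /=; lia.
  have ez : slide_end_at la S (a, b) = (slide la R (a, b)).2 by [].
  have mem_s e : in_diag la e -> a <= e.1 -> b <= e.2 -> (e == (a, b)) || (e \in s).
    case: e => i j el ai bj; rewrite (mem_suffix_cells _ _ _ hla) el xpair_eqE /after.
    by rewrite /= in ai bj *; lia.
  have ne w : w \in s -> w != (a, b) by apply: contraTN => /eqP->.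
  case: (eqVneq (get S (a, b)) k) => [Sz|nSz].
    have := slide_level ab (etrans Rz Sz); have := slide_end R ab.
    move: ez; case: (slide la R (a, b)) => T' e /= ez [el ae be _] [lev ek].
    have es := mem_s e el ae be.
    (* Before the slide, [e] held an entry below [k] or was the unprocessed cell [(a, b)], so no
       earlier slide accounts for it. *)
    have fresh w : w \in s -> get S w = k -> slide_end_at la S w != e.
      move=> ws wk; have [ws' wk'] := IH1 w ws wk; apply/eqP => we.
      rewrite we in ws' wk'; case: ek => [ee|]; last by rewrite wk' ltnn.
      by rewrite ee (negbTE zs) in ws'.
    split.
    + move=> w; rewrite !inE => /orP[/eqP-> _|ws wk].
        by rewrite ez; split=> //; apply/eqP; rewrite lev eqxx.
      have [ws' wk'] := IH1 w ws wk; rewrite ws' orbT; split=> //.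
      by apply/eqP; rewrite lev (ne _ ws') wk' eqxx orbT.
    + move=> y ys /eqP; rewrite lev => /orP[/eqP->|/andP[yz /eqP yk]].
        by exists (a, b); rewrite mem_head ez.
      rewrite inE (negbTE yz) /= in ys.
      have [w [ws wk wy]] := IH2 y ys yk; exists w; split=> //.
      by rewrite inE ws orbT.
    + move=> w w'; rewrite !inE => /orP[/eqP->|ws] /orP[/eqP->|ws'] // wk wk'.
      * by rewrite ez => /esym e1; have := fresh w' ws' wk'; rewrite e1 eqxx.
      * by rewrite ez => e1; have := fresh w ws wk; rewrite e1 eqxx.
      * exact: IH3.
  have Rlt : get R (a, b) < k by rewrite Rz ltn_neqAle nSz Sk.
  have lev := slide_below_level ab Rlt.
  have nz w : w \in (a, b) :: s -> get S w = k -> w \in s.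
    by rewrite inE => /orP[/eqP->|//] e; rewrite e eqxx in nSz.
  split.
  + move=> w /nz h wk; have [ws' wk'] := IH1 w (h wk) wk; rewrite inE ws' orbT.
    by split=> //; apply/eqP; rewrite lev wk'.
  + move=> y ys /eqP; rewrite lev => /eqP yk.
    have ys' : y \in s.
      by move: ys; rewrite inE => /orP[/eqP ey|//]; rewrite ey in yk; rewrite yk ltnn in Rlt.
    have [w [ws wk wy]] := IH2 y ys' yk; exists w; split=> //.
    by rewrite inE ws orbT.
  + by move=> w w' /nz h /nz h' wk wk'; apply: IH3; auto.
Qed.

(** * Exchanging k with a large value *)

Lemma get_transp la k l T x : map size T = la -> in_diag la x ->
  get (transp_tab k l T) x =
  if get T x == k then l else if get T x == l then k else get T x.
Proof.
move=> eT /andP[xs xs']; have iT : x.1 < size T by rewrite -(size_map size) eT.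
rewrite /get /getT /transp_tab (nth_map [::]) // (nth_map 0) //.
by rewrite -eT (nth_map [::]) in xs'.
Qed.

Lemma get_trunc_le k T x : get (trunc k T) x <= k.
Proof. by rewrite get_trunc geq_minl. Qed.

Lemma map_size_transp k l T : map size (transp_tab k l T) = map size T.
Proof. by rewrite -map_comp; apply: eq_map => r /=; rewrite size_map. Qed.

Lemma transp_tabK la k l T : map size T = la -> transp_tab k l (transp_tab k l T) = T.
Proof.
move=> eT; apply: (getT_ext (d := 0) (la := la)); rewrite ?map_size_transp //.
move=> x xl; rewrite -!/(get _ _) (get_transp (la := la)) ?map_size_transp //.
rewrite (get_transp _ _ eT) //.
case: (get T x =P k) => [->|nk]; first by rewrite eqxx; case: (l =P k).
case: (get T x =P l) => [->|nl]; first by rewrite eqxx.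
by rewrite (introF eqP nk) (introF eqP nl).
Qed.

Lemma transp_tabloid la n k l T : sumn la = n -> 0 < k <= n -> 0 < l <= n ->
  is_tabloid la n T -> is_tabloid la n (transp_tab k l T).
Proof.
move=> sn kn ln /(tabloidP _ sn)[eT rT iT]; apply/(tabloidP _ sn); split.
- by rewrite map_size_transp.
- by move=> x xl; rewrite (get_transp _ _ eT) //; have := rT _ xl; do 2! case: ifP => // _.
- move=> x y xl yl; rewrite !(get_transp _ _ eT) // => e; apply: iT => //; move: e.
  case: (get T x =P k); case: (get T y =P k); case: (get T x =P l); case: (get T y =P l);
    congruence.
Qed.

Lemma trunc_transp la k l T : map size T = la -> k <= l ->
  trunc k (transp_tab k l T) = trunc k T.
Proof.
move=> eT kl; apply: (trunc_ext (la := la)) => //; first by rewrite map_size_transp.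
move=> x xl; rewrite (get_transp _ _ eT) //.
by case: eqP => [->|_]; [lia|case: eqP => [->|//]; lia].
Qed.

Lemma pos_ofP n la T k : is_partition n la -> is_tabloid la n T -> 1 <= k <= n ->
  in_diag la (pos_of la T k) /\ get T (pos_of la T k) = k.
Proof.
move=> hla tT kn; have sn : sumn la = n by case/and3P: hla => _ _ /eqP.
case/(tabloidP T sn): (tT) => eT rT iT.
have : k \in flatten T.
  by case/andP: tT => _ /perm_mem ->; rewrite mem_iota; lia.
rewrite (flatten_row_cells eT) => /mapP[x]; rewrite mem_row_cells => xl ek.
have hk : has (fun z => get T z == k) (cells la).
  by apply/hasP; exists x; rewrite ?(mem_cells _ hla) // ek.
split; last exact/eqP/(nth_find (0, 0) hk).
by rewrite -(mem_cells _ hla) mem_nth // -has_find.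
Qed.

(** The entry [k] is not changed by truncation, so its slide has the same final cell in [T] and in
    [trunc k T]. As entries are distinct, the position of [k] after the slide is this cell. *)
Lemma get_T_at n la T k a b x : is_partition n la -> is_tabloid la n T ->
  in_diag la (a, b) -> in_diag la x -> get T (a, b) = k ->
  (get (T_at la T (a, b)) x == k) = (slide_end_at la (trunc k T) (a, b) == x).
Proof.
move=> hla tT ab xl Tk; have sn : sumn la = n by case/and3P: hla => _ _ /eqP.
have bh := in_diag_head hla ab.
have ac : a < col_len la b by rewrite (lt_col_len _ _ hla).
rewrite /T_at (nps_run_suffix _ hla ab) nps_suffix_slides suffix_cells_cons //=.
have [tR so _ _ _ _] := state_suffix hla bh ac tT.
rewrite nps_suffix_slides in tR so.
have Rk : get (slides la T (suffix_cells la a.+1 b)) (a, b) = k.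
  by rewrite (slides_before _ hla) // /after /=; lia.
have [_ e2] := slide_trunc k hla ab tR so.
rewrite /slide_end_at /= (trunc_slides k hla bh ac tT) e2 ?Rk //.
have := slide_end (slides la T (suffix_cells la a.+1 b)) ab.
have := slide_tabloid sn ab tR.
case: (slide la _ _) => T' e /=; rewrite Rk => tT' [el _ _ ek].
apply/eqP/eqP => [xk|<-//].
by case/(tabloidP _ sn): tT' => _ _; apply; rewrite // ek.
Qed.

Theorem theorem7 (n k : nat) (la : seq nat) (x : nat * nat) :
  1 <= k <= n -> is_partition n la -> in_diag la x ->
  let Dom := fun (T : tab) (l : nat) => in_T_k_to_x la n k x T /\ k <= l <= n in
  let Cod := fun (HU : htab * tab) =>
    is_hook_tableau la HU.1 /\ is_SYT la n HU.2 /\ k <= get HU.2 x in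
  (forall T l, Dom T l -> Cod (Psi la k T l)) /\
  (forall T1 l1 T2 l2, Dom T1 l1 -> Dom T2 l2 ->
     Psi la k T1 l1 = Psi la k T2 l2 -> T1 = T2 /\ l1 = l2) /\
  (forall H U, Cod (H, U) -> exists T l, Dom T l /\ Psi la k T l = (H, U)).
Proof.
move=> kn hla xl Dom Cod; have sn : sumn la = n by case/and3P: hla => _ _ /eqP.
have h0 : 0 < head 0 la by case: x xl {Dom Cod} => i j /(in_diag_head hla); lia.
have mem z : (z \in suffix_cells la 0 0) = in_diag la z.
  by rewrite -(cells_suffix h0) (mem_cells _ hla).
pose s := suffix_cells la 0 0.
have bij T := @slide_end_at_bij n la k (trunc k T) 0 0 hla
  (fun z _ => get_trunc_le k T z) h0 (leq0n _).
have PhiE T : Phi la T =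
    ((nps_suffix la (T, H0 la) s).2, slides la T s).
  rewrite (Phi_suffix _ hla h0) -(nps_suffix_slides la T (H0 la)).
  by case: nps_suffix.
have final T y : is_tabloid la n T ->
    (k <= get (slides la T s) y) = (get (slides la (trunc k T) s) y == k).
  move=> tT; rewrite (trunc_slides k hla h0 (leq0n _) tT) get_trunc.
  by rewrite (sameP eqP minn_idPl).
have domP T l : Dom T l -> [/\ is_tabloid la n T, map size T = la, 1 <= l <= n & k <= l] /\
    [/\ in_diag la (pos_of la T k), get T (pos_of la T k) = k
      & slide_end_at la (trunc k T) (pos_of la T k) = x].
  move=> [/andP[tT Tx] kl]; have [wl wk] := pos_ofP hla tT kn.
  split; first by split; [| by case/andP: tT => /eqP | lia | lia].
  split=> //; move: Tx wl wk; case: (pos_of la T k) => a b Tx wl wk.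
  by apply/eqP; rewrite -(get_T_at hla tT wl xl wk).
split; [|split].
- move=> T l /domP[[tT eT ln kl] [wl wk wx]]; rewrite /Psi.
  have tT' := transp_tabloid sn kn ln tT; set T' := transp_tab k l T in tT' *.
  have := state_suffix hla h0 (leq0n _) tT'; rewrite -/s (surjective_pairing (nps_suffix _ _ _)).
  move=> /(state_final _ _ hla h0); rewrite nps_suffix_slides => -[syt hook].
  rewrite /Cod PhiE; split=> //; split=> //=.
  rewrite (final _ _ tT') (trunc_transp eT kl) -wx.
  have [b1 _ _] := bij T; have [||_ ->//] := b1 (pos_of la T k); first by rewrite mem.
  by rewrite get_trunc wk minnn.
- move=> T1 l1 T2 l2 /domP[[t1 e1 ln1 kl1] [w1l w1k w1x]].
  move=> /domP[[t2 e2 ln2 kl2] [w2l w2k w2x]]; rewrite /Psi => eP.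
  have t1' := transp_tabloid sn kn ln1 t1; have t2' := transp_tabloid sn kn ln2 t2.
  have eT : transp_tab k l1 T1 = transp_tab k l2 T2.
    apply: (nps_suffix_inj hla h0 (leq0n _) t1' t2').
    move: eP; rewrite !(Phi_suffix _ hla h0).
    by do 2! case: nps_suffix => ? ?; case=> -> ->.
  (* Exchanging [k] with a large value is invisible after truncation. *)
  have eS : trunc k T1 = trunc k T2.
    by rewrite -(trunc_transp e1 kl1) -(trunc_transp e2 kl2) eT.
  (* Both positions are sent to [x] by [slide_end_at] for the common truncation, and this map is
     injective on large cells. *)
  have ew : pos_of la T1 k = pos_of la T2 k.
    have [_ _ b3] := bij T2; apply: b3; rewrite ?mem ?get_trunc ?w2k ?minnn //.
      by rewrite -get_trunc -eS get_trunc w1k minnn.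
    by rewrite w2x -eS.
  (* In either case [l] is the entry of the common transposed tabloid at the common position of
     [k]. *)
  have el : l1 = l2.
    have := get_transp k l1 e1 w1l; rewrite w1k eqxx eT ew.
    by rewrite (get_transp k l2 e2 w2l) w2k eqxx.
  by split=> //; rewrite -(transp_tabK k l1 e1) eT el (transp_tabK k l2 e2).
- move=> H U [/= hook [syt kU]].
  have [T' tT' eT'] := nps_suffix_surj hla h0 (leq0n _)
    ((state_final U H hla h0).2 (conj syt hook)).
  have eU : slides la T' s = U by rewrite -(nps_suffix_slides la T' (H0 la)) eT'.
  have [eT rT _] := tabloidP T' sn tT'.
  have [_ b2 _] := bij T'.
  (* The entry of [U] at [x] is large, so [x] is the final cell belonging to some large cell [w] of
     [T']. *)
  have [||w [ws wk wx]] := b2 x; first by rewrite mem.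
    by apply/eqP; rewrite -(final _ _ tT') eU.
  rewrite mem in ws; rewrite get_trunc in wk.
  pose l := get T' w; have kl : k <= l by rewrite /l; lia.
  have ln : 1 <= l <= n by have := rT _ ws; rewrite /l; lia.
  (* Exchanging [k] with the entry [l] of [T'] at [w] puts [k] into [w]. The truncation stays the
     same, so the slide of [k] ends at [x]. *)
  exists (transp_tab k l T'), l.
  have tT := transp_tabloid sn kn ln tT'.
  split; last by rewrite /Psi (transp_tabK k l eT) PhiE eT' /= eU.
  split; last by lia.
  apply/andP; split=> //.
  have Tw : get (transp_tab k l T') w = k.
    by rewrite (get_transp k l eT ws) -/l eqxx; case: eqP.
  have [pl pk] := pos_ofP hla tT kn.
  have ew : pos_of la (transp_tab k l T') k = w.
    by have [_ _] := tabloidP _ sn tT; apply; rewrite // pk Tw.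
  rewrite ew; rewrite (surjective_pairing w) in ws Tw wx *.
  by rewrite (get_T_at hla tT ws xl Tw) (trunc_transp eT kl) wx.
Qed.
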